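(* Let $\lambda=(\lambda_1,\ldots,\lambda_m)$ be a partition of length $m$ (that is, with $m$ positive parts), and let $p_\lambda=p_{\lambda_1}\cdots p_{\lambda_m}$ be the corresponding power symmetric function. Then $p_\lambda$ is an eigenvector for $D$, with $$D(p_\lambda)=\begin{cases}0 & \text{if some } \lambda_i \text{ is even},\\ 2^m p_\lambda & \text{if every part of } \lambda \text{ is odd}.\end{cases}$$
   Context: $\mathcal{S}$ is the algebra of symmetric functions over $\mathbb{Q}$, with basis the Schur functions $S_\lambda$ indexed by all partitions $\lambda$. $p_n=\sum_i x_i^n$ for $n\ge1$. $D:\mathcal{S}\to\mathcal{S}$ is the linear map defined by $D(S_\lambda)=\sum_{\mu\subseteq\lambda}S_\mu S_{(\lambda/\mu)'}$, where $S_{(\lambda/\mu)'}$ is the skew Schur function of the conjugate skew shape $(\lambda/\mu)'=\lambda'/\mu'$. *)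

(* Defs.v *)
From HB Require Import structures.
From mathcomp Require Import all_boot all_order all_fingroup all_algebra.
From mathcomp Require Import mpoly boolp zify.

Set Implicit Arguments.
Unset Strict Implicit.
Unset Printing Implicit Defensive.

Import GRing.Theory.
Local Open Scope ring_scope.

Definition is_part (s : seq nat) : bool := sorted geq s && (0%N \notin s).

Record intpart := IntPart { parts :> seq nat; partsP : is_part parts }.

HB.instance Definition _ := [isSub for parts].
HB.instance Definition _ := [Countable of intpart by <:].

Definition part (la : intpart) (i : nat) : nat := nth 0%N la i.

Lemma part_anti (la : intpart) i j : (i <= j)%N -> (part la j <= part la i)%N.
Proof.
move=> le_ij; have /andP[s_sorted _] := partsP la; move: s_sorted.
rewrite /part; set s := parts la => s_sorted.
have [lt_js|/(nth_default 0%N) -> //] := ltnP j (size s).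
have geq_trans : transitive geq by move=> a b c /[swap]; apply: leq_trans.
by apply: (sorted_leq_nth geq_trans leqnn); rewrite ?inE // (leq_ltn_trans le_ij).
Qed.

Lemma part_gt0 (la : intpart) i : (0 < part la i)%N = (i < size la)%N.
Proof.
have /andP[_] := partsP la; rewrite /part lt0n; set s := parts la => s0.
have [lt_is|/(nth_default 0%N) -> //] := ltnP i (size s).
by apply: contraNN s0 => /eqP <-; apply: mem_nth.
Qed.

Lemma part_head (la : intpart) i : (part la i <= head 0%N la)%N.
Proof. by rewrite -nth0; apply: part_anti. Qed.

Lemma part_inj (la mu : intpart) : part la =1 part mu -> la = mu.
Proof.
move=> eq_p; apply: val_inj; apply: (@eq_from_nth _ 0%N) => [|i _]; last exact: eq_p.
have lt_sz i : (i < size la)%N = (i < size mu)%N by rewrite -!part_gt0 eq_p.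
by apply/eqP; rewrite eqn_leq leqNgt lt_sz ltnn leqNgt -lt_sz ltnn.
Qed.

Definition empty_part : intpart := @IntPart [::] isT.

Lemma conj_part_subproof (la : intpart) :
  is_part [seq count (fun p => j < p)%N la | j <- iota 0 (head 0%N la)].
Proof.
apply/andP; split.
  apply: (homo_sorted (e := leq)); last exact: iota_sorted.
  by move=> i j le_ij; apply: sub_count => p; apply: leq_ltn_trans.
apply/negP => /mapP[j]; rewrite mem_iota add0n => /andP[_ lt_j] /eqP.
rewrite eq_sym -leqn0 leqNgt -has_count => /hasPn/(_ (head 0%N la)).
rewrite lt_j; case: (la : seq nat) lt_j => //= a s _; rewrite mem_head.
by move=> /(_ isT).
Qed.

(* [(conj_part la)_j] is the number of parts of [la] that exceed [j]. *)
Definition conj_part (la : intpart) : intpart :=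
  IntPart (conj_part_subproof la).

Lemma part_conj (la : intpart) i j :
  (j < part (conj_part la) i)%N = (i < part la j)%N.
Proof.
rewrite /part /=; have [lt_i|le_i] := ltnP i (head 0%N la); last first.
  rewrite [nth _ (map _ _) _]nth_default ?size_map ?size_iota // ltn0.
  by rewrite ltnNge (leq_trans (part_head la j)).
rewrite (nth_map 0%N) ?size_iota // nth_iota // add0n.
have := @part_anti la; rewrite /part.
elim: (la : seq nat) j => [|a s IHs] j anti //=; first by rewrite nth_nil.
have anti_s i' j' : (i' <= j')%N -> (nth 0 s j' <= nth 0 s i')%N.
  by move=> le; apply: (anti i'.+1 j'.+1).
case: j => [|j] /=; last first.
  rewrite -IHs //; case: (ltnP i a) => // le_ai.
  have s0 : count (fun p => i < p)%N s = 0%N.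
    apply/eqP; rewrite -leqn0 leqNgt -has_count -all_predC.
    apply/(all_nthP 0%N) => k _ /=; rewrite -leqNgt.
    exact: leq_trans (anti 0%N k.+1 isT) le_ai.
  by rewrite s0.
case: (ltnP i a) => // le_ai; rewrite add0n.
rewrite -has_count; apply/negbTE; rewrite -all_predC.
apply/(all_nthP 0%N) => k _ /=; rewrite -leqNgt.
exact: leq_trans (anti 0%N k.+1 isT) le_ai.
Qed.

Definition included (mu la : intpart) : bool :=
  all (fun i => part mu i <= part la i)%N (iota 0 (size mu)).

Lemma includedP (mu la : intpart) :
  reflect (forall i, (part mu i <= part la i)%N) (included mu la).
Proof.
apply: (iffP allP) => [le_p i|le_p i _] //.
have [lt_i|le_i] := ltnP i (size mu); first by apply: le_p; rewrite mem_iota.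
by rewrite /part nth_default.
Qed.

Definition subpartitions (la : intpart) : seq intpart :=
  [seq mu <- pmap insub
     [seq map val (val s) | s : (size la).-bseq 'I_(head 0%N la).+1]
   | included mu la].

Lemma subpartitions_uniq la : uniq (subpartitions la).
Proof.
rewrite filter_uniq // pmap_sub_uniq // map_inj_uniq ?enum_uniq //.
by move=> s t /(inj_map val_inj) /val_inj.
Qed.

Lemma mem_subpartitions la mu : (mu \in subpartitions la) = included mu la.
Proof.
rewrite mem_filter andbC; case: includedP; rewrite ?andbF ?andbT // => le_p.
rewrite mem_pmap_sub; apply/mapP.
have sz : (size mu <= size la)%N.
  rewrite leqNgt -part_gt0; apply/negP => /leq_trans/(_ (le_p _)).
  by rewrite part_gt0 ltnn.
have sz' : (size [seq inord p : 'I_(head 0%N la).+1 | p <- mu] <= size la)%N.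
  by rewrite size_map.
exists (Bseq sz'); rewrite ?mem_enum //=.
rewrite -map_comp map_id_in // => p /(nthP 0%N)[i lt_i <-] /=.
rewrite inordK // ltnS; exact: leq_trans (le_p i) (part_head la i).
Qed.

Definition mpoly_family := forall n : nat, {mpoly rat[n]}.

HB.instance Definition _ := Choice.on mpoly_family.

Section FamilyAlgebra.

Implicit Types f g h : mpoly_family.

Lemma familyP f g : (forall n, f n = g n) -> f = g.
Proof. exact: functional_extensionality_dep. Qed.

Definition family_zero : mpoly_family := fun n => 0.
Definition family_one : mpoly_family := fun n => 1.
Definition family_opp f : mpoly_family := fun n => - f n.
Definition family_add f g : mpoly_family := fun n => f n + g n.
Definition family_mul f g : mpoly_family := fun n => f n * g n.
Definition family_scale (a : rat) f : mpoly_family := fun n => a *: f n.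

Fact family_addA : associative family_add.
Proof. by move=> f g h; apply: familyP => n; apply: addrA. Qed.
Fact family_addC : commutative family_add.
Proof. by move=> f g; apply: familyP => n; apply: addrC. Qed.
Fact family_add0 : left_id family_zero family_add.
Proof. by move=> f; apply: familyP => n; apply: add0r. Qed.
Fact family_addN : left_inverse family_zero family_opp family_add.
Proof. by move=> f; apply: familyP => n; apply: addNr. Qed.

HB.instance Definition _ := GRing.isZmodule.Build mpoly_family
  family_addA family_addC family_add0 family_addN.

Fact family_mulA : associative family_mul.
Proof. by move=> f g h; apply: familyP => n; apply: mulrA. Qed.
Fact family_mulC : commutative family_mul.
Proof. by move=> f g; apply: familyP => n; apply: mulrC. Qed.
Fact family_mul1 : left_id family_one family_mul.
Proof. by move=> f; apply: familyP => n; apply: mul1r. Qed.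
Fact family_mulD : left_distributive family_mul family_add.
Proof. by move=> f g h; apply: familyP => n; apply: mulrDl. Qed.
Fact family_one_neq0 : family_one != family_zero.
Proof.
by apply/eqP => /(congr1 (fun f => f 0%N)) /eqP; rewrite oner_eq0.
Qed.

HB.instance Definition _ := GRing.Zmodule_isComNzRing.Build mpoly_family
  family_mulA family_mulC family_mul1 family_mulD family_one_neq0.

Fact family_scaleA a b f :
  family_scale a (family_scale b f) = family_scale (a * b) f.
Proof. by apply: familyP => n; apply: scalerA. Qed.
Fact family_scale1 : left_id 1 family_scale.
Proof. by move=> f; apply: familyP => n; apply: scale1r. Qed.
Fact family_scaleDr : right_distributive family_scale +%R.
Proof. by move=> a f g; apply: familyP => n; apply: scalerDr. Qed.
Fact family_scaleDl f : {morph family_scale^~ f : a b / a + b}.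
Proof. by move=> a b; apply: familyP => n; apply: scalerDl. Qed.

HB.instance Definition _ := GRing.Zmodule_isLmodule.Build rat mpoly_family
  family_scaleA family_scale1 family_scaleDr family_scaleDl.

Fact family_scaleAl (a : rat) f g : a *: (f * g) = (a *: f) * g.
Proof. by apply: familyP => n; apply: scalerAl. Qed.

HB.instance Definition _ :=
  GRing.Lmodule_isLalgebra.Build rat mpoly_family family_scaleAl.

Fact family_scaleAr (a : rat) f g : a *: (f * g) = f * (a *: g).
Proof. by apply: familyP => n; apply: scalerAr. Qed.

HB.instance Definition _ :=
  GRing.Lalgebra_isAlgebra.Build rat mpoly_family family_scaleAr.

Definition component n f : {mpoly rat[n]} := f n.

Fact component_is_linear n : linear (component n).
Proof. by []. Qed.
HB.instance Definition _ n := GRing.isLinear.Build rat mpoly_family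
  {mpoly rat[n]} _ (component n) (component_is_linear n).

Fact component_is_monoid_morphism n : monoid_morphism (component n).
Proof. by []. Qed.
HB.instance Definition _ n := GRing.isMonoidMorphism.Build mpoly_family
  {mpoly rat[n]} (component n) (component_is_monoid_morphism n).

End FamilyAlgebra.

(* [p(x_0, ..., x_(n-1), 0)] *)
Definition drop_last_var n (p : {mpoly rat[n.+1]}) : {mpoly rat[n]} :=
  p \mPo [tuple oapp (fun j => 'X_j) 0 (unlift ord_max i) | i < n.+1].

(* A symmetric function is a symmetric formal power series of bounded degree  *)
(* in [x_0, x_1, ...]. It is represented, as an element of the inverse limit  *)
(* of the rings of symmetric polynomials, by its truncations                  *)
(* [f n = f(x_0, ..., x_(n-1), 0, 0, ...)].                                   *)
Definition symfun_pred : pred mpoly_family := fun f =>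
  `[< [/\ forall n, f n \is symmetric,
          forall n, drop_last_var (f n.+1) = f n
        & exists d, forall n, (msize (f n) <= d)%N] >].

Fact symfun_subalg_closed : subalg_closed symfun_pred.
Proof.
split.
- apply/asboolP; split=> [n|n|]; first exact: rpred1.
    by rewrite /drop_last_var comp_mpoly1.
  by exists 1%N => n; rewrite msize1.
- move=> a f g /asboolP[fS fr [d fd]] /asboolP[gS gr [e ge]].
  apply/asboolP; split=> [n|n|].
  + by apply: rpredD; [apply: rpredZ; apply: fS | apply: gS].
  + rewrite -[RHS]/(a *: f n + g n) -fr -gr /drop_last_var.
    by rewrite -comp_mpolyZ -comp_mpolyD.
  + exists (maxn d e) => n; apply: leq_trans (msizeD_le _ _) _.
    rewrite geq_max leq_max (leq_trans (msizeZ_le _ _)) //= leq_max.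
    by rewrite ge orbT.
- move=> f g /asboolP[fS fr [d fd]] /asboolP[gS gr [e ge]].
  apply/asboolP; split=> [n|n|].
  + by apply: rpredM; [apply: fS | apply: gS].
  + by rewrite -[RHS]/(f n * g n) -fr -gr /drop_last_var -rmorphM.
  + exists (d + e).+1 => n; apply: leq_trans (msizeM_le (f n) (g n)) _.
    by rewrite ltnS leq_add.
Qed.

HB.instance Definition _ := GRing.isSubalgClosed.Build rat mpoly_family
  symfun_pred symfun_subalg_closed.

Record symfun := Symfun { family_of : mpoly_family;
                          family_ofP : family_of \in symfun_pred }.

HB.instance Definition _ := [isSub for family_of].
HB.instance Definition _ := [Choice of symfun by <:].
HB.instance Definition _ := [SubChoice_isSubComNzRing of symfun by <:].
HB.instance Definition _ := [SubZmodule_isSubLmodule of symfun by <:].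
HB.instance Definition _ := [SubNzRing_SubLmodule_isSubLalgebra of symfun by <:].
HB.instance Definition _ := [SubLalgebra_isSubAlgebra of symfun by <:].

Lemma family_ofE (f : symfun) n : drop_last_var (family_of f n.+1) = family_of f n.
Proof. by have /asboolP[_ ->] := family_ofP f. Qed.

Lemma drop_last_varX n (i : 'I_n.+1) :
  drop_last_var ('X_i) = oapp (fun j => 'X_j) 0 (unlift ord_max i).
Proof. by rewrite /drop_last_var comp_mpolyXU -tnth_nth tnth_mktuple. Qed.

(* [p_0] is not a symmetric function; [psum 0] is 0 by convention. *)
Definition psum_family (k : nat) : mpoly_family := fun n =>
  if (0 < k)%N then \sum_(i < n) 'X_i ^+ k else 0.

Fact psum_subproof k : psum_family k \in symfun_pred.
Proof.
rewrite /psum_family; case: ltnP => [k_gt0|_]; last first.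
  apply/asboolP; split=> [n|n|]; first exact: rpred0.
    by rewrite /drop_last_var comp_mpoly0.
  by exists 0%N => n; rewrite msize0.
apply/asboolP; split=> [n|n|].
- apply/issymP => s; rewrite raddf_sum [RHS](reindex_perm s) /=.
  by apply: eq_bigr => i _; rewrite rmorphXn /= /msym mmapX mmap1U.
- rewrite big_ord_recr /= /drop_last_var raddfD raddf_sum /= !rmorphXn /=.
  rewrite -/(drop_last_var _) drop_last_varX unlift_none /= expr0n.
  rewrite -[(k == 0)%N]negbK -lt0n k_gt0 addr0; apply: eq_bigr => i _.
  rewrite rmorphXn /= -/(drop_last_var _) drop_last_varX.
  by rewrite (_ : widen_ord _ i = lift ord_max i) ?liftK //; apply: val_inj; exact: esym (lift_max i).
- exists k.+1 => n; apply: leq_trans (msize_sum _ _ _) _.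
  apply/bigmax_leqP => i _; rewrite mpolyXn msizeX mdegMn mdeg1.
  by rewrite mul1n.
Qed.

Definition psum (k : nat) : symfun := Symfun (psum_subproof k).

Section SkewShape.

Variables la mu : intpart.

(* Rows and columns are numbered from 0. When [mu] is not contained in [la],  *)
(* the cells are those of the diagram of [la] that are not in that of [mu].   *)
Definition cell :=
  {c : 'I_(size la) * 'I_(head 0%N la) | (part mu c.1 <= c.2 < part la c.1)%N}.
HB.instance Definition _ := Finite.on cell.

Definition crow (c : cell) : nat := (val c).1.
Definition ccol (c : cell) : nat := (val c).2.

Lemma cell_inj c d : crow c = crow d -> ccol c = ccol d -> c = d.
Proof.
move=> eq_r eq_c; apply: val_inj; move: eq_r eq_c; rewrite /crow /ccol.
by case: (val c) (val d) => [a b] [a' b'] /= /val_inj -> /val_inj ->.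
Qed.

Lemma cellP c : (part mu (crow c) <= ccol c < part la (crow c))%N.
Proof. exact: valP c. Qed.

Lemma ex_cell i j : (part mu i <= j < part la i)%N ->
  exists2 c, crow c = i & ccol c = j.
Proof.
move=> ij_in; have /andP[_ lt_j] := ij_in.
have lt_i : (i < size la)%N by rewrite -part_gt0; apply: leq_ltn_trans lt_j.
have lt_j' := leq_trans lt_j (part_head la i).
by exists (Sub (Ordinal lt_i, Ordinal lt_j') ij_in : cell).
Qed.

Lemma cell_between c d i j :
  (crow c <= i <= crow d)%N -> (ccol c <= j <= ccol d)%N ->
  exists2 e, crow e = i & ccol e = j.
Proof.
move=> /andP[ci id] /andP[cj jd]; apply: ex_cell.
have /andP[le_c _] := cellP c; have /andP[_ lt_d] := cellP d.
rewrite (leq_trans (part_anti mu ci)) ?(leq_trans le_c) //=.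
by rewrite (leq_ltn_trans jd) // (leq_trans lt_d) // part_anti.
Qed.

Definition semistandard n (T : {ffun cell -> 'I_n}) : bool :=
  [forall c, forall d,
     ((crow c == crow d) && (ccol c < ccol d) ==> (T c <= T d)) &&
     ((ccol c == ccol d) && (crow c < crow d) ==> (T c < T d))]%N.

Lemma semistandardP n (T : {ffun cell -> 'I_n}) :
  reflect ((forall c d, crow c = crow d -> ccol c < ccol d -> T c <= T d) /\
           (forall c d, ccol c = ccol d -> crow c < crow d -> T c < T d))%N
          (semistandard T).
Proof.
apply: (iffP idP) => [/forallP ssT|[rT cT]].
  by split=> c d e lt; have /forallP/(_ d)/andP[] := ssT c; rewrite e eqxx lt.
apply/forallP => c; apply/forallP => d; apply/andP; split; apply/implyP.
  by move=> /andP[/eqP]; apply: rT.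
by move=> /andP[/eqP]; apply: cT.
Qed.

Definition skew_schur_family : mpoly_family := fun n =>
  \sum_(T : {ffun cell -> 'I_n} | semistandard T) \prod_c 'X_(T c).

Lemma drop_last_var_skew_schur n :
  drop_last_var (skew_schur_family n.+1) = skew_schur_family n.
Proof.
pose h (T : {ffun cell -> 'I_n}) := [ffun c => lift ord_max (T c)].
have h_inj : injective h.
  move=> T1 T2 /ffunP eqT; apply/ffunP => c; have := eqT c.
  by rewrite !ffunE; apply: lift_inj.
have ss_h T : semistandard (h T) = semistandard T.
  by apply: eq_forallb => c; apply: eq_forallb => d; rewrite !ffunE !lift_max.
have h_ex (T : {ffun cell -> 'I_n.+1}) :
  (forall c, T c != ord_max) -> exists T', T = h T'.
  move=> Tmax.
  have /fin_all_exists[T' T'P] c : exists j, T c = lift ord_max j.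
    by case: (unliftP ord_max (T c)) (Tmax c) => [j ->|-> /eqP//]; exists j.
  by exists (finfun T'); apply/ffunP => c; rewrite !ffunE.
rewrite /skew_schur_family /drop_last_var raddf_sum /=.
transitivity (\sum_(T in h @: [set T | semistandard T])
                drop_last_var (\prod_c 'X_(T c))); last first.
  rewrite big_imset /=; last by move=> ? ? _ _; apply: h_inj.
  apply: eq_big => [T|T _]; first by rewrite inE.
  rewrite /drop_last_var rmorph_prod /=; apply: eq_bigr => c _.
  by rewrite -/(drop_last_var _) drop_last_varX ffunE liftK.
rewrite big_mkcond [RHS]big_mkcond /=; apply: eq_bigr => T _.
have [/forallP Tmax|/forallPn[c]] := boolP [forall c, T c != ord_max].
  have [T' ->] := h_ex T Tmax.
  by rewrite mem_imset ?inE ?ss_h.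
rewrite negbK => /eqP Tc; rewrite [X in _ = if X then _ else _](_ : _ = false).
  case: ifP => // _; rewrite rmorph_prod /= (bigD1 c) //=.
  by rewrite -/(drop_last_var _) drop_last_varX Tc unlift_none mul0r.
apply/negbTE/negP => /imsetP[T' _ eqT]; move: Tc; rewrite eqT ffunE.
by move=> /eqP; rewrite eq_sym (negbTE (neq_lift _ _)).
Qed.

Lemma msize_skew_schur n : (msize (skew_schur_family n) <= #|{: cell}|.+1)%N.
Proof.
apply: leq_trans (msize_sum _ _ _) _; apply/bigmax_leqP => T _.
rewrite mprodXE msizeX mdeg_sum ltnS -sum1_card.
by apply: eq_leq; apply: eq_bigr => c _; rewrite mdeg1.
Qed.

(* Symmetry is proved with the Bender-Knuth involution [bk]: on the set [U]   *)
(* of cells with entry [i] or [i'], [bk_rho] exchanges the two cells of a     *)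
(* column and reverses the order of the remaining cells of each row.          *)
Definition above c d := (crow d == (crow c).+1) && (ccol d == ccol c).

Definition bk_free (U : {set cell}) : {set cell} :=
  [set c in U | [forall d in U, ~~ above c d && ~~ above d c]].

Definition bk_free_row (U : {set cell}) (r : nat) : seq cell :=
  sort (fun c d => (ccol c <= ccol d)%N) (enum [set c in bk_free U | crow c == r]).

Definition bk_rho (U : {set cell}) (c : cell) : cell :=
  if c \notin U then c else
  if [pick d in U | above c d] is Some d then d else
  if [pick d in U | above d c] is Some d then d else
  let s := bk_free_row U (crow c) in nth c (rev s) (index c s).

Definition no_column3 (U : {set cell}) :=
  forall c d e, c \in U -> d \in U -> e \in U -> above c d -> above d e -> False.

Lemma above_injr c d e : above c d -> above c e -> d = e.
Proof.
move=> /andP[/eqP rd /eqP cd] /andP[/eqP re /eqP ce].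
by apply: cell_inj; rewrite ?rd ?cd.
Qed.

Lemma above_injl c d e : above d c -> above e c -> d = e.
Proof.
move=> /andP[/eqP rd /eqP cd] /andP[/eqP re /eqP ce].
by apply: cell_inj; [apply/succn_inj; rewrite -rd | rewrite -cd].
Qed.

Section Rho.

Variable U : {set cell}.
Hypothesis U3 : no_column3 U.

Lemma rho_out c : c \notin U -> bk_rho U c = c.
Proof. by rewrite /bk_rho => ->. Qed.

Lemma rho_above c d : c \in U -> d \in U -> above c d -> bk_rho U c = d.
Proof.
move=> cU dU cd; rewrite /bk_rho cU /=; case: pickP => [e /andP[_ ce]|/(_ d)].
  exact: above_injr ce cd.
by rewrite dU cd.
Qed.

Lemma rho_below c d : c \in U -> d \in U -> above d c -> bk_rho U c = d.
Proof.
move=> cU dU dc; rewrite /bk_rho cU /=; case: pickP => [e /andP[eU ce]|_].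
  by case: (U3 dU cU eU dc ce).
case: pickP => [e /andP[_ ec]|/(_ d)]; first exact: above_injl ec dc.
by rewrite dU dc.
Qed.

Variant rho_spec c : Prop :=
| RhoOut of c \notin U
| RhoAbove d of c \in U & d \in U & above c d
| RhoBelow d of c \in U & d \in U & above d c
| RhoFree of c \in bk_free U.

Lemma rhoP c : rho_spec c.
Proof.
have [cU|] := boolP (c \in U); last exact: RhoOut.
have [cF|] := boolP (c \in bk_free U); first exact: RhoFree.
rewrite inE cU /= => /forall_inPn[d dU]; rewrite negb_and !negbK.
by case/orP; [apply: RhoAbove | apply: RhoBelow].
Qed.

Lemma freeU c : c \in bk_free U -> c \in U.
Proof. by rewrite inE => /andP[]. Qed.

Lemma free_above c d : c \in bk_free U -> d \in U -> above c d = false.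
Proof. by rewrite inE => /andP[_ /forall_inP H] /H/andP[/negbTE]. Qed.

Lemma free_below c d : c \in bk_free U -> d \in U -> above d c = false.
Proof. by rewrite inE => /andP[_ /forall_inP H] /H/andP[_ /negbTE]. Qed.

Lemma mem_free_row r c : (c \in bk_free_row U r) = (c \in bk_free U) && (crow c == r).
Proof. by rewrite mem_sort mem_enum inE. Qed.

Lemma free_row_uniq r : uniq (bk_free_row U r).
Proof. by rewrite sort_uniq enum_uniq. Qed.

Lemma rho_freeE c : c \in bk_free U ->
  let s := bk_free_row U (crow c) in bk_rho U c = nth c (rev s) (index c s).
Proof.
move=> cF; rewrite /bk_rho (freeU cF) /=; case: pickP => [d /andP[dU]|_].
  by rewrite free_above.
by case: pickP => // d /andP[dU]; rewrite free_below.
Qed.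

Lemma rho_free c : c \in bk_free U ->
  [/\ bk_rho U c \in bk_free U, crow (bk_rho U c) = crow c &
      let s := bk_free_row U (crow c) in
      index (bk_rho U c) s = (size s - (index c s).+1)%N].
Proof.
move=> cF; rewrite rho_freeE //; set s := bk_free_row U (crow c).
have cs : c \in s by rewrite mem_free_row cF eqxx.
have lt_c : (index c s < size s)%N by rewrite index_mem.
have lt_c' : (size s - (index c s).+1 < size s)%N.
  by rewrite -subSn // subSS leq_subr.
rewrite nth_rev //; have /(_ c) := mem_nth _ lt_c'.
rewrite mem_free_row => /andP[rF /eqP rr].
by split=> //=; rewrite index_uniq ?free_row_uniq.
Qed.

Lemma rhoK : involutive (bk_rho U).
Proof.
move=> c; have [cU|d cU dU cd|d cU dU dc|cF] := rhoP c.
- by rewrite !rho_out.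
- by rewrite (rho_above cU dU cd) (rho_below dU cU cd).
- by rewrite (rho_below cU dU dc) (rho_above dU cU dc).
have [rF rr ri] := rho_free cF; rewrite (rho_freeE rF) rr; move: ri => /= ->.
set s := bk_free_row U (crow c).
have cs : c \in s by rewrite mem_free_row cF eqxx.
have lt_c : (index c s < size s)%N by rewrite index_mem.
rewrite nth_rev; last by rewrite -subSn // subSS leq_subr.
by rewrite -subSn // subSS subKn 1?ltnW // nth_index.
Qed.

Lemma rho_mem c : (bk_rho U c \in U) = (c \in U).
Proof.
have [cU|d cU dU cd|d cU dU dc|cF] := rhoP c.
- by rewrite rho_out.
- by rewrite (rho_above cU dU cd) cU dU.
- by rewrite (rho_below cU dU dc) cU dU.
by have [/freeU-> _ _] := rho_free cF; rewrite freeU.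
Qed.

Lemma rho_anti c d : c \in bk_free U -> d \in bk_free U -> crow c = crow d ->
  (ccol c < ccol d)%N -> (ccol (bk_rho U d) < ccol (bk_rho U c))%N.
Proof.
move=> cF dF rcd lt_cd; have [cF' cr ci] := rho_free cF.
have [dF' dr di] := rho_free dF; move: ci di; rewrite /= -rcd.
set s := bk_free_row U (crow c) => ci di.
have le_tr : transitive (fun c d => (ccol c <= ccol d)%N).
  by move=> ? ? ?; apply: leq_trans.
have s_sorted : sorted (fun c d => (ccol c <= ccol d)%N) s.
  by apply: sort_sorted => ? ?; apply: leq_total.
have in_s e : e \in bk_free U -> crow e = crow c -> e \in s.
  by move=> eF er; rewrite mem_free_row eF er eqxx.
have [cs ds] : c \in s /\ d \in s by split; apply: in_s.
have [cs' ds'] : bk_rho U c \in s /\ bk_rho U d \in s.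
  by split; apply: in_s => //; rewrite dr.
have le_ind e f : e \in s -> f \in s -> (index e s <= index f s)%N ->
    (ccol e <= ccol f)%N.
  move=> es fs le; rewrite -(nth_index c es) -(nth_index c fs).
  have le_refl : reflexive (fun c d => (ccol c <= ccol d)%N) by move=> ?; apply: leqnn.
  by apply: (sorted_leq_nth le_tr le_refl); rewrite ?inE ?index_mem.
have lt_ind : (index c s < index d s)%N.
  by rewrite ltnNge; apply/negP => /(le_ind _ _ ds cs); rewrite leqNgt lt_cd.
have lt_ind' : (index (bk_rho U d) s < index (bk_rho U c) s)%N.
  move: ds lt_ind; rewrite ci di -index_mem.
  by move: (index d s) (index c s) (size s) => a b z; clear; lia.
rewrite ltn_neqAle le_ind 1?ltnW // andbT; apply/eqP => eq_col.
have eq_rho : bk_rho U d = bk_rho U c by apply: cell_inj; rewrite ?dr ?cr.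
by rewrite eq_rho ltnn in lt_ind'.
Qed.

End Rho.

Section BenderKnuth.

Variables (n : nat) (i i' : 'I_n).
Hypothesis ii' : i' = i.+1 :> nat.

Definition bk_set (T : {ffun cell -> 'I_n}) : {set cell} :=
  [set c | (T c == i) || (T c == i')].

Definition bk (T : {ffun cell -> 'I_n}) : {ffun cell -> 'I_n} :=
  [ffun c => tperm i i' (T (bk_rho (bk_set T) c))].

Lemma bk_setE T c : (c \in bk_set T) = (i <= T c <= i')%N.
Proof.
rewrite inE -!val_eqE /= ii'.
by move: (nat_of_ord (T c)) (nat_of_ord i) => a b; clear; lia.
Qed.

Variable T : {ffun cell -> 'I_n}.
Hypothesis T_ss : semistandard T.
Let U := bk_set T.

Let T_row c d : crow c = crow d -> (ccol c < ccol d)%N -> (T c <= T d)%N.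
Proof. by case/semistandardP: T_ss => rT _; apply: rT. Qed.

Let T_col c d : ccol c = ccol d -> (crow c < crow d)%N -> (T c < T d)%N.
Proof. by case/semistandardP: T_ss => _; apply. Qed.

Lemma bk_above c d : c \in U -> d \in U -> above c d -> T c = i /\ T d = i'.
Proof.
move=> cU dU /andP[/eqP rd /eqP cd].
have lt_T : (T c < T d)%N by apply: T_col; rewrite ?cd ?rd.
move: cU dU; rewrite !inE => /orP[] /eqP Tc /orP[] /eqP Td; rewrite Tc Td //.
- by rewrite Tc Td ltnn in lt_T.
- by rewrite Tc Td ii' ltnNge leqnSn in lt_T.
- by rewrite Tc Td ltnn in lt_T.
Qed.

Lemma bk_no_column3 : no_column3 U.
Proof.
move=> c d e cU dU eU /(bk_above cU dU)[_ Td] /(bk_above dU eU)[Td' _].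
by move: ii'; rewrite -Td -Td' => /n_Sn.
Qed.
Let U3 := bk_no_column3.

Lemma bk_out c : c \notin U -> bk T c = T c.
Proof.
move=> cU; rewrite ffunE rho_out //; move: cU; rewrite inE negb_or.
by move=> /andP[ci ci']; rewrite tpermD // eq_sym.
Qed.

Lemma bk_set_bk : bk_set (bk T) = U.
Proof.
apply/setP => c; rewrite -[RHS](rho_mem U3) !inE ffunE.
by case: tpermP => [->|->|/eqP/negbTE-> /eqP/negbTE->]; rewrite ?eqxx ?orbT.
Qed.

Lemma bkK : bk (bk T) = T.
Proof.
apply/ffunP => c; rewrite ffunE bk_set_bk ffunE tpermK.
by rewrite -/U (rhoK U3).
Qed.

Lemma bk_forced c d : c \in U -> d \in U -> above c d || above d c ->
  bk T c = T c.
Proof.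
move=> cU dU /orP[] cd; rewrite ffunE -/U.
  by have [Tc Td] := bk_above cU dU cd; rewrite (rho_above cU dU cd) Td tpermR.
by have [Td Tc] := bk_above dU cU cd; rewrite (rho_below U3 cU dU cd) Td tpermL.
Qed.

Lemma bk_mem c : c \in U -> bk T c = i \/ bk T c = i'.
Proof.
by rewrite -bk_set_bk inE => /orP[] /eqP ->; [left | right].
Qed.

Lemma bk_semistandard : semistandard (bk T).
Proof.
have ltii' : (i < i')%N by rewrite ii'.
have out_lt c : c \notin U -> (T c < i)%N || (i' < T c)%N.
  by rewrite bk_setE negb_and -!ltnNge.
have bkU c : c \in U -> (i <= bk T c <= i')%N by rewrite -bk_set_bk bk_setE.
have TU c : c \in U -> (i <= T c <= i')%N by rewrite bk_setE.
have out_le c d : ~~ ((c \in U) && (d \in U)) ->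
    ((T c <= T d -> bk T c <= bk T d) /\ (T c < T d -> bk T c < bk T d))%N.
  have [cU|cU] := boolP (c \in U); have [dU|dU] := boolP (d \in U) => // _.
  - rewrite [bk T d]bk_out //.
    have := out_lt d dU; have := TU c cU; have := bkU c cU; clear -ltii'; lia.
  - rewrite [bk T c]bk_out //.
    have := out_lt c cU; have := TU d dU; have := bkU d dU; clear -ltii'; lia.
  - by rewrite !bk_out.
apply/semistandardP; split=> c d e lt_cd; last first.
  have ltT := T_col e lt_cd.
  have [/andP[cU dU]|out] := boolP ((c \in U) && (d \in U)); last first.
    by have [_ ->] := out_le c d out.
  have cd : above c d.
    rewrite /above e eqxx andbT; apply/eqP/anti_leq; rewrite lt_cd andbT.
    rewrite leqNgt; apply/negP => lt_cd'.
    have [f rf cf] : exists2 f, crow f = (crow c).+1 & ccol f = ccol c.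
      by apply: (@cell_between c d); rewrite ?leqnSn ?leqnn ?e ?leqnn // ltnW.
    have Tf : (T c < T f)%N by apply: T_col; rewrite ?rf ?cf.
    have Tf' : (T f < T d)%N by apply: T_col; rewrite ?rf ?cf ?e.
    have := TU c cU; have := TU d dU; clear -Tf Tf' ii'; lia.
  rewrite (bk_forced cU dU) ?cd // (bk_forced dU cU) ?cd ?orbT //.
have leT := T_row e lt_cd.
have [/andP[cU dU]|out] := boolP ((c \in U) && (d \in U)); last first.
  by have [->] := out_le c d out.
case: (bk_mem cU) => bkc; first by rewrite bkc; case/andP: (bkU d dU).
case: (bk_mem dU) => bkd; last by rewrite bkd; case/andP: (bkU c cU).
have eqi (j : 'I_n) : (i <= j)%N -> (j <= i)%N -> j = i.
  by move=> le_ij le_ji; apply: val_inj; apply: anti_leq; rewrite /= le_ij le_ji.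
have freeN_r f : f \in U -> above f c -> T d = i' -> exists2 g, g \in U & above g d.
  move=> fU fc Td; have [Tf Tc] := bk_above fU cU fc.
  case/andP: fc => /eqP rf /eqP cf.
  have [g rg cg] : exists2 g, crow g = crow f & ccol g = ccol d.
    apply: (@cell_between f d); first by rewrite -e rf leqnn leqnSn.
    by rewrite -cf leqnn ltnW.
  exists g; last by rewrite /above -e rf rg cg !eqxx.
  have : (T f <= T g)%N by apply: T_row; rewrite ?rg // cg -cf.
  have : (T g < T d)%N by apply: T_col; rewrite ?cg // rg -e rf.
  rewrite bk_setE Tf Td; clear; lia.
have freeN_l f : f \in U -> above d f -> T c = i -> exists2 g, g \in U & above c g.
  move=> fU df Tc; have [Td Tf] := bk_above dU fU df.
  case/andP: df => /eqP rf /eqP cf.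
  have [g rg cg] : exists2 g, crow g = crow f & ccol g = ccol c.
    apply: (@cell_between c f); first by rewrite rf -e leqnn leqnSn.
    by rewrite cf leqnn ltnW.
  exists g; last by rewrite /above rg rf e cg !eqxx.
  have : (T g <= T f)%N by apply: T_row; rewrite ?rg // cg cf.
  have : (T c < T g)%N by apply: T_col; rewrite ?cg // rg rf e.
  rewrite bk_setE Tf Tc; clear; lia.
have neq : i' != i by rewrite -val_eqE /= ii' gtn_eqF.
exfalso; move: leT.
have [|f _ fU cf|f _ fU fc|cF] := rhoP U c; first by rewrite cU.
- have [Tc _] := bk_above cU fU cf.
  by move: bkc; rewrite (bk_forced cU fU) ?cf // Tc => /esym/eqP; rewrite (negbTE neq).
- have [_ Tc] := bk_above fU cU fc => leT.
  have Td : T d = i'.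
    by apply: val_inj; apply: anti_leq; rewrite /= -{2}Tc leT andbT; case/andP: (TU d dU).
  have [g gU gd] := freeN_r f fU fc Td.
  move: bkd; rewrite (bk_forced dU gU) ?gd ?orbT // Td => /eqP.
  by rewrite (negbTE neq).
have [|f _ fU df|f _ fU fd|dF] := rhoP U d; first by rewrite dU.
- have [Td _] := bk_above dU fU df => leT.
  have Tc : T c = i by apply: eqi; [case/andP: (TU c cU) | rewrite -Td].
  by have [g gU cg] := freeN_l f fU df Tc; rewrite (free_above cF gU) in cg.
- have [_ Td] := bk_above fU dU fd.
  by move: bkd; rewrite (bk_forced dU fU) ?fd ?orbT // Td => /eqP; rewrite (negbTE neq).
move=> _; have [_ rc _] := rho_free cF; have [_ rd _] := rho_free dF.
have : (T (bk_rho U d) <= T (bk_rho U c))%N.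
  by apply: T_row; rewrite ?rc ?rd ?e //; apply: rho_anti.
have -> : T (bk_rho U c) = i.
  by apply: (can_inj (tpermK i i')); rewrite tpermL -[RHS]bkc ffunE.
have -> : T (bk_rho U d) = i'.
  by apply: (can_inj (tpermK i i')); rewrite tpermR -[RHS]bkd ffunE.
by rewrite ii' ltnn.
Qed.

End BenderKnuth.

Lemma msym_skew_schur_step n (i i' : 'I_n) : i' = i.+1 :> nat ->
  msym (tperm i i') (skew_schur_family n) = skew_schur_family n.
Proof.
move=> ii'; rewrite /skew_schur_family raddf_sum /=.
rewrite [RHS](reindex_onto (bk i i') (bk i i')) /=; last first.
  by move=> T; apply: bkK.
apply: eq_big => [T|T T_ss].
  apply/idP/andP => [T_ss|[bk_ss /eqP <-]]; last exact: bk_semistandard bk_ss.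
  by rewrite (bk_semistandard ii' T_ss) (bkK ii' T_ss).
rewrite rmorph_prod /= (reindex_inj (can_inj (rhoK (bk_no_column3 ii' T_ss)))) /=.
by apply: eq_bigr => c _; rewrite /msym mmapX mmap1U ffunE.
Qed.

Lemma skew_schur_symmetric n : skew_schur_family n \is symmetric.
Proof.
set p := skew_schur_family n.
have fixM s t : msym s p = p -> msym t p = p -> msym (s * t)%g p = p.
  by move=> sp tp; rewrite msymMm sp.
have fix_lt k (i j : 'I_n) : j = (i + k)%N :> nat -> msym (tperm i j) p = p.
  elim: k j => [|k IHk] j ij.
    by rewrite (_ : j = i) ?tperm1 ?msym1m //; apply: val_inj; rewrite /= ij addn0.
  have lt_k : (i + k < n)%N by have := ltn_ord j; rewrite ij addnS; apply: ltnW.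
  pose l := Ordinal lt_k.
  have il := IHk l erefl.
  have lj : msym (tperm l j) p = p by apply: msym_skew_schur_step; rewrite ij addnS.
  case: k IHk lt_k @l il lj ij => [|k] IHk lt_k l il lj ij.
    by rewrite (_ : i = l) //; apply: val_inj; rewrite /= addn0.
  have -> : tperm i j = (tperm l j * (tperm i l * tperm l j))%g.
    rewrite -[X in (X * _)%g]tpermV -conjgE tpermJ tpermL tpermD //.
      by rewrite -val_eqE /= addnS -addSn gtn_eqF // leq_addr.
    by rewrite -val_eqE /= ij addnS -addSn gtn_eqF // leq_addr.
  by apply: (fixM _ _ lj); apply: fixM.
have fix_tperm (i j : 'I_n) : msym (tperm i j) p = p.
  have [le_ij|/ltnW le_ji] := leqP i j.
    by apply: (fix_lt (j - i)%N); rewrite subnKC.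
  by rewrite tpermC; apply: (fix_lt (i - j)%N); rewrite subnKC.
apply/issymP => s; have [ts -> _] := prod_tpermP s.
elim: ts => [|t ts IHts]; first by rewrite big_nil msym1m.
by rewrite big_cons fixM.
Qed.

Fact skew_schur_subproof : skew_schur_family \in symfun_pred.
Proof.
apply/asboolP; split; [exact: skew_schur_symmetric | exact: drop_last_var_skew_schur |].
by exists #|{: cell}|.+1; apply: msize_skew_schur.
Qed.

Definition skew_schur : symfun := Symfun skew_schur_subproof.

End SkewShape.

Definition schur (la : intpart) : symfun := skew_schur la empty_part.

Definition psum_part (la : intpart) : symfun := \prod_(k <- la) psum k.

(* Main.v *)
(* Let [peel hstrip x] and [peel vstrip y] be the operators that remove a
   horizontal or a vertical strip, weighted by [x] or [y] to the number of cells.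
   Cutting a tableau at each value of its entries expresses a Schur function as
   an iterate of the first, and the value of [D] on it as an iterate of both:
   the super Schur function [s_la(X/X)] of an alphabet with a horizontal and a
   vertical letter for each variable.
   All super Schur functions satisfy the same Pieri rule: adding horizontal
   strips of size [k] multiplies by the super analogue of [h_k]. For a horizontal
   letter this follows from a reflection of the rows of partitions; a vertical
   letter [y] undoes the horizontal letter [-y], and inherits the rule from it.
   By Newton's identities, [p_k] then acts on the indices of Schur functions by an
   operator that does not depend on the alphabet. Hence the expansion of [p_la]
   in Schur functions becomes, under [D], the product of the super power sums
   [\sum_i x_i ^ k - \sum_i (- x_i) ^ k] of [X/X]. *)
From HB Require Import structures.
Require Import Defs.
From mathcomp Require Import all_boot all_order all_algebra.
From mathcomp Require Import mpoly boolp zify ring.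

Set Implicit Arguments.
Unset Strict Implicit.
Unset Printing Implicit Defensive.

Import GRing.Theory.
Local Open Scope ring_scope.

(** * Reindexing of sums over duplicate-free sequences *)

Lemma sum_bij (V : nmodType) (I J : eqType) (r : seq I) (s : seq J)
    (P : pred I) (Q : pred J) (F : I -> V) (G : J -> V)
    (h : I -> J) (g : J -> I) :
  uniq r -> uniq s ->
  (forall i, i \in r -> P i ->
     [/\ h i \in s, Q (h i), g (h i) = i & F i = G (h i)]) ->
  (forall j, j \in s -> Q j -> [/\ g j \in r, P (g j) & h (g j) = j]) ->
  \sum_(i <- r | P i) F i = \sum_(j <- s | Q j) G j.
Proof.
move=> r_uniq s_uniq hP gP; rewrite -big_filter -[RHS]big_filter.
have eq_perm : perm_eq [seq h i | i <- r & P i] [seq j <- s | Q j].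
  apply: uniq_perm; last 1 first.
  - move=> j; rewrite mem_filter; apply/mapP/andP => [[i]|[Qj js]].
      by rewrite mem_filter => /andP[Pi ri] ->; have [] := hP i ri Pi.
    have [gr Pg hg] := gP j js Qj.
    by exists (g j); rewrite ?mem_filter ?Pg.
  - rewrite map_inj_in_uniq ?filter_uniq // => i i'.
    rewrite !mem_filter => /andP[Pi ri] /andP[Pi' ri'] eq_h.
    by have [_ _ <- _] := hP i ri Pi; have [_ _ <- _] := hP i' ri' Pi';
       rewrite eq_h.
  - exact: filter_uniq.
rewrite -(perm_big _ eq_perm) big_map; apply: eq_big_seq => i.
rewrite mem_filter => /andP[Pi ri].
by have [] := hP i ri Pi.
Qed.

Lemma sum_same (V : nmodType) (I : eqType) (r s : seq I) (P Q : pred I)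
    (F : I -> V) :
  uniq r -> uniq s -> (forall i, (i \in r) && P i = (i \in s) && Q i) ->
  \sum_(i <- r | P i) F i = \sum_(i <- s | Q i) F i.
Proof.
move=> r_uniq s_uniq eq_rs; apply: (sum_bij (h := id) (g := id)) => // i ir Pi.
  by have := eq_rs i; rewrite ir Pi => /esym/andP[].
by have := eq_rs i; rewrite ir Pi => /andP[].
Qed.

(** * Partitions and strips *)

Fixpoint mkparts (f : nat -> nat) (N : nat) : seq nat :=
  if N is N'.+1 then
    if (f 0 == 0)%N then [::] else f 0%N :: mkparts (fun i => f i.+1) N'
  else [::].

(* Junk value [empty_part] when [f] is not nonincreasing. *)
Definition mkpart f N : intpart := insubd empty_part (mkparts f N).

Lemma mkparts_is_part f N : (forall i, f i.+1 <= f i)%N -> is_part (mkparts f N).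
Proof.
elim: N f => //= N IHN f anti; case: ifP => // f0.
have /andP[srt nz] := IHN (fun i => f i.+1) (fun i => anti i.+1).
rewrite /is_part inE negb_or (eq_sym 0%N) f0 nz andbT /=.
case: N {IHN nz} srt => //= N; case: ifP => //= _ ->.
by rewrite !andbT; apply: anti.
Qed.

Lemma part_mkpart f N : (forall i, f i.+1 <= f i)%N -> f N = 0%N ->
  part (mkpart f N) =1 f.
Proof.
move=> anti fN i; rewrite /part /mkpart /= val_insubd mkparts_is_part //.
elim: N f anti fN i => [|N IHN] f anti fN i /=.
  rewrite nth_nil; elim: i => // i IHi.
  by apply/esym/eqP; rewrite -leqn0 IHi.
case: ifP => [/eqP f0|f0].
  rewrite nth_nil {fN}; elim: i => // i IHi.
  by apply/esym/eqP; rewrite -leqn0 IHi.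
by case: i => //= i; apply: (IHN (fun i => f i.+1) _ fN i) => j; apply: anti.
Qed.

Lemma part_default (la : intpart) i : (size la <= i)%N -> part la i = 0%N.
Proof. exact: nth_default. Qed.

Lemma partS (la : intpart) i : (part la i.+1 <= part la i)%N.
Proof. exact: part_anti. Qed.

Lemma sumn_partE (la : intpart) N : (size la <= N)%N ->
  sumn la = (\sum_(i < N) part la i)%N.
Proof.
move=> le_N; rewrite sumnE (big_nth 0%N) -(big_mkord xpredT (part la)).
rewrite (big_cat_nat (leq0n _) le_N) //= [X in (_ + X)%N]big_nat_cond.
rewrite [X in (_ + X)%N]big1 ?addn0 //.
by move=> i /andP[/andP[le_i _] _]; apply: part_default.
Qed.

Lemma sumn_add1 (la mu : intpart) j :
  (forall i, part mu i = part la i + (i == j))%N ->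
  sumn mu = (sumn la).+1.
Proof.
move=> eq_p; pose N := (size la + size mu + j.+1)%N.
rewrite (@sumn_partE la N) ?(@sumn_partE mu N) /N; try lia.
rewrite (eq_bigr _ (fun (i : 'I__) _ => eq_p i)) big_split /=.
have lt_j : (j < size la + size mu + j.+1)%N by lia.
rewrite [X in (_ + X)%N](bigD1 (Ordinal lt_j)) //= eqxx.
rewrite [X in (_ + (_ + X))%N]big1; first by lia.
by move=> i; rewrite -val_eqE /= => /negbTE ->.
Qed.

Lemma includedE (mu la : intpart) :
  included mu la -> forall i, (part mu i <= part la i)%N.
Proof. by move/includedP. Qed.

Lemma included_refl la : included la la.
Proof. exact/includedP. Qed.

Lemma included_trans la mu nu : included la mu -> included mu nu -> included la nu.
Proof.
move=> /includedP lm /includedP mn; apply/includedP => i.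
exact: leq_trans (mn i).
Qed.

Lemma included_sumn mu la : included mu la -> (sumn mu <= sumn la)%N.
Proof.
move=> /includedP le_p; pose N := (size la + size mu)%N.
rewrite (@sumn_partE la N) ?(@sumn_partE mu N) /N; try lia.
by apply: leq_sum => i _.
Qed.

Lemma included_sumn_diff mu la i : included mu la ->
  (part la i + sumn mu <= part mu i + sumn la)%N.
Proof.
move=> /includedP le_p; pose N := (size la + size mu + i.+1)%N.
rewrite (@sumn_partE la N) ?(@sumn_partE mu N) /N; try lia.
have lt_i : (i < size la + size mu + i.+1)%N by lia.
rewrite (bigD1 (Ordinal lt_i)) //= [X in (_ <= _ + X)%N](bigD1 (Ordinal lt_i)) //=.
rewrite addnCA leq_add2l leq_add2l.
exact: leq_sum.
Qed.

Lemma included_eq mu la : included mu la -> sumn mu = sumn la -> mu = la.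
Proof.
move=> mula eq_s; apply: part_inj => i; have := included_sumn_diff i mula.
have := includedE mula i; lia.
Qed.

Definition hstrip (la mu : intpart) : bool :=
  `[< forall i, part la i.+1 <= part mu i /\ part mu i <= part la i >]%N.

Definition vstrip (la mu : intpart) : bool :=
  `[< forall i, part mu i <= part la i /\ part la i <= (part mu i).+1 >]%N.

Lemma hstripP la mu :
  reflect (forall i, part la i.+1 <= part mu i /\ part mu i <= part la i)%N
    (hstrip la mu).
Proof. exact: asboolP. Qed.

Lemma vstripP la mu :
  reflect (forall i, part mu i <= part la i /\ part la i <= (part mu i).+1)%N
    (vstrip la mu).
Proof. exact: asboolP. Qed.

Lemma hstrip_included la mu : hstrip la mu -> included mu la.
Proof. by move=> /hstripP H; apply/includedP => i; case: (H i). Qed.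

Lemma vstrip_included la mu : vstrip la mu -> included mu la.
Proof. by move=> /vstripP H; apply/includedP => i; case: (H i). Qed.

Lemma hstrip_refl la : hstrip la la.
Proof. by apply/hstripP => i; split; rewrite ?partS. Qed.

Lemma vstrip_refl la : vstrip la la.
Proof. by apply/vstripP => i; split; rewrite ?leqnSn. Qed.

(** The top row grows by [k], and every other row takes the length of the row above it in [la], the
    most that a horizontal strip allows. This gives one finite range for all the partitions that
    [addh] sums over. *)
Definition box (la : intpart) k : intpart :=
  mkpart (fun i => if i is j.+1 then part la j else part la 0 + k)%N (size la).+1.

Lemma part_box la k i :
  part (box la k) i = (if i is j.+1 then part la j else part la 0 + k)%N.
Proof.
rewrite part_mkpart ?(@part_default _ (size la)) //.
case=> [|j]; first exact: leq_addr.
exact: partS.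
Qed.

Lemma hstrip_box la nu k :
  hstrip nu la -> (sumn nu <= sumn la + k)%N -> included nu (box la k).
Proof.
move=> hs eq_s; apply/includedP => -[|i]; rewrite part_box.
  have := included_sumn_diff 0 (hstrip_included hs); lia.
by have /hstripP/(_ i)[] := hs.
Qed.

Definition add_box (la : intpart) j : intpart :=
  mkpart (fun i => part la i + (i == j))%N (size la + j.+1).

Definition del_box (la : intpart) j : intpart :=
  mkpart (fun i => part la i - (i == j))%N (size la).

Lemma part_add_box la j : (forall i, j = i.+1 -> part la j < part la i)%N ->
  forall i, part (add_box la j) i = (part la i + (i == j))%N.
Proof.
move=> corner; apply: part_mkpart => [i|]; last by rewrite part_default; lia.
have := corner i; have := partS la i; have [->|] := eqVneq i.+1 j; last lia.
by move=> ? /(_ erefl); lia.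
Qed.

Lemma part_del_box la j : (part la j.+1 < part la j)%N ->
  forall i, part (del_box la j) i = (part la i - (i == j))%N.
Proof.
move=> corner; apply: part_mkpart => [i|]; last by rewrite part_default.
have := partS la i; have [-> ?|] := eqVneq i j; last lia.
by rewrite gtn_eqF //; lia.
Qed.

(* For fixed [la] and [mu], this exchanges the [nu] such that [nu / la] and
   [nu / mu] are horizontal strips, with smallest possible first row, and the
   [ka] such that [la / ka] and [mu / ka] are horizontal strips. *)
Definition reflect_down (la mu nu : intpart) : intpart :=
  mkpart (fun i => minn (part la i) (part mu i) +
    maxn (part la i.+1) (part mu i.+1) - part nu i.+1)%N (size la + size mu).

Definition reflect_up (la mu ka : intpart) : intpart :=
  mkpart (fun i => if i is j.+1
    then minn (part la j) (part mu j) + maxn (part la i) (part mu i) - part ka j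
    else maxn (part la 0) (part mu 0))%N (size la + size mu).+1.

Lemma part_reflect_down la mu nu : hstrip nu la -> hstrip nu mu ->
  forall i, part (reflect_down la mu nu) i =
    (minn (part la i) (part mu i) +
     maxn (part la i.+1) (part mu i.+1) - part nu i.+1)%N.
Proof.
move=> /hstripP hl /hstripP hm; apply: part_mkpart => [i|].
  have := hl i; have := hl i.+1; have := hl i.+2;
  have := hm i; have := hm i.+1; have := hm i.+2; lia.
by rewrite !(@part_default la) ?(@part_default mu); lia.
Qed.

Lemma part_reflect_up la mu ka : hstrip la ka -> hstrip mu ka ->
  forall i, part (reflect_up la mu ka) i = (if i is j.+1
    then minn (part la j) (part mu j) + maxn (part la i) (part mu i) - part ka j
    else maxn (part la 0) (part mu 0))%N.
Proof.
move=> /hstripP hl /hstripP hm; apply: part_mkpart => [[|i]|].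
- have := hl 0%N; have := hm 0%N; lia.
- have := hl i; have := hl i.+1; have := hm i; have := hm i.+1; lia.
- by rewrite !(@part_default la) ?(@part_default mu); lia.
Qed.

(** Summed over all rows, the right side gives all minima and all maxima except the maximum of row
    0, which is the first row of [nu]; a minimum and a maximum add up to [part la i + part mu i]. *)
Lemma sumn_reflect la mu nu ka :
  part nu 0%N = maxn (part la 0%N) (part mu 0%N) ->
  (forall i, part ka i + part nu i.+1 = minn (part la i) (part mu i) +
     maxn (part la i.+1) (part mu i.+1))%N ->
  (sumn ka + sumn nu = sumn la + sumn mu)%N.
Proof.
move=> nu0 eqS; pose N := (size la + size mu + size nu + size ka)%N.
rewrite (@sumn_partE la N) ?(@sumn_partE mu N) ?(@sumn_partE nu N.+1)
  ?(@sumn_partE ka N) /N; try lia.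
rewrite -/N big_ord_recl /= addnCA -big_split /= (eq_bigr _ (fun (i : 'I__) _ => eqS i)).
rewrite big_split /= addnCA nu0.
rewrite -(big_ord_recl _ (fun i => maxn (part la i) (part mu i))) big_ord_recr /=.
rewrite !(@part_default _ N) /N; try lia.
rewrite addn0 -!big_split /=; apply: eq_bigr => i _; lia.
Qed.

(** * Adding and removing strips *)

Definition addh (V : zmodType) k (f : intpart -> V) (la : intpart) : V :=
  \sum_(nu <- subpartitions (box la k) | hstrip nu la && (sumn nu == sumn la + k)%N)
    f nu.

Definition peel (R : comNzRingType) (strip : rel intpart) (x : R)
    (f : intpart -> R) (la : intpart) : R :=
  \sum_(mu <- subpartitions la | strip la mu) x ^+ (sumn la - sumn mu) * f mu.

Lemma addh0 (V : zmodType) (f : intpart -> V) la : addh 0 f la = f la.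
Proof.
rewrite /addh -[RHS](big_seq1 +%R la f).
apply: sum_same; rewrite ?subpartitions_uniq // => nu.
rewrite inE andbT mem_subpartitions addn0.
apply/and3P/eqP => [[_ hs /eqP]|->].
  by move=> eq_s; apply/esym/included_eq => //; apply: hstrip_included.
by split; rewrite ?hstrip_refl //; apply: hstrip_box; rewrite ?hstrip_refl ?addn0.
Qed.

(** A first row of [nu] beyond its smallest possible length ends in a cell whose removal keeps both
    strip conditions; this cell is the factor [x]. *)
Lemma sum_first_row (R : comNzRingType) (x : R) la mu k :
  \sum_(nu <- subpartitions (box la k.+1) |
      [&& hstrip nu la, hstrip nu mu, (sumn nu == sumn la + k.+1)%N &
          part nu 0%N != maxn (part la 0%N) (part mu 0%N)])
    x ^+ (sumn nu - sumn mu) =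
  x * \sum_(nu <- subpartitions (box la k) |
      [&& hstrip nu la, hstrip nu mu & (sumn nu == sumn la + k)%N])
    x ^+ (sumn nu - sumn mu).
Proof.
rewrite big_distrr /=.
have delP nu : hstrip nu la -> hstrip nu mu ->
    part nu 0%N != maxn (part la 0%N) (part mu 0%N) ->
    forall i, part (del_box nu 0%N) i = (part nu i - (i == 0))%N.
  move=> /hstripP hl /hstripP hm nu0 i; apply: part_del_box.
  have := hl 0%N; have := hm 0%N; lia.
have addP nu : forall i, part (add_box nu 0%N) i = (part nu i + (i == 0))%N.
  by apply: part_add_box.
apply: (sum_bij (h := del_box^~ 0%N) (g := add_box^~ 0%N));
  rewrite ?subpartitions_uniq // => nu.
- move=> _ /and4P[hl hm /eqP eq_s nu0].
  have dP := delP nu hl hm nu0.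
  move/hstripP: (hl) => hl'; move/hstripP: (hm) => hm'.
  have s_del : sumn nu = (sumn (del_box nu 0%N)).+1.
    apply: (@sumn_add1 _ _ 0%N) => i; rewrite dP.
    have := hl' 0%N; have := hm' 0%N; case: i => [|i] /=; lia.
  have hl1 : hstrip (del_box nu 0%N) la.
    apply/hstripP => i; have := hl' i; rewrite !dP; case: i => [|i] /=; last lia.
    have := hm' 0%N; lia.
  have hm1 : hstrip (del_box nu 0%N) mu.
    apply/hstripP => i; have := hm' i; rewrite !dP; case: i => [|i] /=; last lia.
    have := hl' 0%N; lia.
  split.
  + by rewrite mem_subpartitions; apply: hstrip_box => //; lia.
  + rewrite hl1 hm1 /=; lia.
  + apply: part_inj => i; rewrite addP dP.
    have := hl' 0%N; have := hm' 0%N; case: i => [|i] /=; lia.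
  + rewrite -exprS; congr (x ^+ _).
    have := included_sumn (hstrip_included hm1); lia.
- move=> _ /and3P[/hstripP hl /hstripP hm /eqP eq_s].
  have s_add := sumn_add1 (addP nu).
  have hl1 : hstrip (add_box nu 0%N) la.
    by apply/hstripP => i; have := hl i; rewrite !addP; case: i => [|i] /=; lia.
  have hm1 : hstrip (add_box nu 0%N) mu.
    by apply/hstripP => i; have := hm i; rewrite !addP; case: i => [|i] /=; lia.
  have nu0 : part (add_box nu 0%N) 0%N != maxn (part la 0%N) (part mu 0%N).
    by rewrite addP /=; have := hl 0%N; have := hm 0%N; lia.
  split.
  + by rewrite mem_subpartitions; apply: hstrip_box => //; lia.
  + by rewrite hl1 hm1 nu0 andbT /=; lia.
  + by apply: part_inj => i; rewrite delP // addP addnK.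
Qed.

(** With the first row as short as possible, reflecting the rows is a bijection. It preserves the
    weight because [ka] and [nu] together have as many cells as [la] and [mu]. *)
Lemma sum_reflect (R : comNzRingType) (x : R) la mu k :
  \sum_(nu <- subpartitions (box la k) |
      [&& hstrip nu la, hstrip nu mu, (sumn nu == sumn la + k)%N &
          part nu 0%N == maxn (part la 0%N) (part mu 0%N)])
    x ^+ (sumn nu - sumn mu) =
  \sum_(ka <- subpartitions la |
      [&& hstrip la ka, hstrip mu ka & (sumn mu == sumn ka + k)%N])
    x ^+ (sumn la - sumn ka).
Proof.
apply: (sum_bij (h := reflect_down la mu) (g := reflect_up la mu));
  rewrite ?subpartitions_uniq //.
- move=> nu _ /and4P[hl hm /eqP eq_s /eqP nu0].
  have dP := part_reflect_down hl hm; set ka := reflect_down la mu nu in dP *.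
  move/hstripP: (hl) => hl'; move/hstripP: (hm) => hm'.
  have hs : (sumn ka + sumn nu = sumn la + sumn mu)%N.
    apply: sumn_reflect => // i; rewrite dP.
    have := hl' i; have := hl' i.+1; have := hm' i; have := hm' i.+1; lia.
  have hl1 : hstrip la ka.
    apply/hstripP => i; rewrite dP.
    have := hl' i; have := hl' i.+1; have := hm' i; have := hm' i.+1; lia.
  have hm1 : hstrip mu ka.
    apply/hstripP => i; rewrite dP.
    have := hl' i; have := hl' i.+1; have := hm' i; have := hm' i.+1; lia.
  split; first by rewrite mem_subpartitions hstrip_included.
  + rewrite hl1 hm1 /=; lia.
  + apply: part_inj => i; rewrite part_reflect_up //.
    case: i => [|i] //; rewrite dP.
    have := hl' i; have := hl' i.+1; have := hm' i; have := hm' i.+1; lia.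
  + by congr (x ^+ _); lia.
- move=> ka _ /and3P[hl hm /eqP eq_s].
  have uP := part_reflect_up hl hm; set nu := reflect_up la mu ka in uP *.
  move/hstripP: (hl) => hl'; move/hstripP: (hm) => hm'.
  have hs : (sumn ka + sumn nu = sumn la + sumn mu)%N.
    apply: sumn_reflect; first by rewrite uP.
    move=> i; rewrite uP.
    have := hl' i; have := hl' i.+1; have := hm' i; have := hm' i.+1; lia.
  have hl1 : hstrip nu la.
    apply/hstripP => i; rewrite !uP; case: i => [|i].
      have := hl' 0%N; have := hm' 0%N; lia.
    have := hl' i; have := hl' i.+1; have := hm' i; have := hm' i.+1; lia.
  have hm1 : hstrip nu mu.
    apply/hstripP => i; rewrite !uP; case: i => [|i].
      have := hl' 0%N; have := hm' 0%N; lia.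
    have := hl' i; have := hl' i.+1; have := hm' i; have := hm' i.+1; lia.
  split; first by rewrite mem_subpartitions; apply: hstrip_box => //; lia.
  + by rewrite hl1 hm1 uP eqxx andbT /=; lia.
  + apply: part_inj => i; rewrite part_reflect_down // uP.
    have := hl' i; have := hl' i.+1; have := hm' i; have := hm' i.+1; lia.
Qed.

(** With [A(t)] the generating series of the operators [addh k] and [P] the operator
    [peel hstrip x], this is [(1 - x t) A(t) P = P A(t)] in positive degrees. The coefficients of
    each [f mu] agree: the [nu] with a long first row give the first term on the right, the others
    are reflected into the second. *)
Lemma addh_peel (R : comNzRingType) (x : R) f la k :
  addh k.+1 (peel hstrip x f) la =
  x * addh k (peel hstrip x f) la + peel hstrip x (addh k.+1 f) la.
Proof.
(* [M] contains every [mu] that either side meets, so that coefficients can be compared over one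
   range. *)
pose M := subpartitions (box la k.+1).
have M_uniq : uniq M by apply: subpartitions_uniq.
have box_le : included (box la k) (box la k.+1).
  by apply/includedP => -[|i]; rewrite !part_box ?leq_add2l.
have addhE j : (j <= k.+1)%N -> addh j (peel hstrip x f) la =
    \sum_(mu <- M) f mu * \sum_(nu <- subpartitions (box la j) |
       [&& hstrip nu la, hstrip nu mu & (sumn nu == sumn la + j)%N])
         x ^+ (sumn nu - sumn mu).
  move=> le_j; under [RHS]eq_bigr do rewrite big_distrr.
  rewrite (exchange_big_dep (fun nu => hstrip nu la && (sumn nu == sumn la + j)%N)) /=;
    last by move=> mu nu _ /and3P[h1 _ h2]; apply/andP.
  rewrite /addh big_seq_cond [RHS]big_seq_cond; apply: eq_bigr => nu.
  rewrite mem_subpartitions => /andP[nu_box /andP[nu_la nu_s]].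
  rewrite /peel; transitivity (\sum_(mu <- M | hstrip nu mu)
    x ^+ (sumn nu - sumn mu) * f mu); last first.
    by apply: eq_big => [mu|mu _]; rewrite ?nu_la ?nu_s ?andbT // mulrC.
  apply: sum_same; rewrite ?subpartitions_uniq // => mu.
  rewrite !mem_subpartitions; case: (boolP (hstrip nu mu)); rewrite ?andbF //.
  move=> hs; rewrite hstrip_included // (included_trans (hstrip_included hs)) //.
  apply: hstrip_box => //; lia.
have peelE : peel hstrip x (addh k.+1 f) la =
    \sum_(mu <- M) f mu * \sum_(ka <- subpartitions la |
      [&& hstrip la ka, hstrip mu ka & (sumn mu == sumn ka + k.+1)%N])
        x ^+ (sumn la - sumn ka).
  under [RHS]eq_bigr do rewrite big_distrr.
  rewrite (exchange_big_dep (hstrip la)) /=; last by move=> mu ka _ /and3P[].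
  rewrite /peel; apply: eq_bigr => ka la_ka; rewrite /addh big_distrr /=.
  transitivity (\sum_(mu <- M | hstrip mu ka && (sumn mu == sumn ka + k.+1)%N)
    x ^+ (sumn la - sumn ka) * f mu); last first.
    by apply: eq_big => [mu|mu _]; rewrite ?la_ka // mulrC.
  apply: sum_same; rewrite ?subpartitions_uniq // => mu.
  rewrite !mem_subpartitions; case: (boolP (hstrip mu ka && _)); rewrite ?andbF //.
  move=> /andP[hs /eqP s_mu]; rewrite hstrip_box ?s_mu //.
  have := hstrip_box hs (eq_leq s_mu) => /included_trans -> //.
  apply/includedP => i; rewrite !part_box; move/hstripP: la_ka => la_ka.
  case: i => [|i]; last by have := la_ka i; lia.
  by have := la_ka 0%N; lia.
rewrite peelE !addhE // big_distrr -big_split /=; apply: eq_bigr => mu _.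
rewrite mulrCA -mulrDr; congr (_ * _).
rewrite -sum_first_row -sum_reflect.
rewrite (bigID (fun nu => part nu 0%N != maxn (part la 0%N) (part mu 0%N))) /=.
by congr (_ + _); apply: eq_bigl => nu; rewrite -!andbA ?negbK.
Qed.

(* The cell of [ka] in the last row where [la] and [mu] differ can be added or
   removed freely, and the two choices cancel. *)
Lemma sum_toggle (R : comNzRingType) (y : R) la mu : included mu la ->
  \sum_(ka <- subpartitions la | hstrip la ka && vstrip ka mu)
    (- y) ^+ (sumn la - sumn ka) * y ^+ (sumn ka - sumn mu) = (mu == la)%:R.
Proof.
move=> mula; have [->|neq] := eqVneq mu la.
  transitivity (\sum_(ka <- [:: la])
      (- y) ^+ (sumn la - sumn ka) * y ^+ (sumn ka - sumn la)).
    apply: sum_same; rewrite ?subpartitions_uniq // => ka.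
    rewrite inE andbT mem_subpartitions; apply/and3P/eqP => [[kala _ laka]|->].
      apply: included_eq => //; apply/eqP.
      by rewrite eqn_leq !included_sumn // vstrip_included.
    by rewrite included_refl hstrip_refl vstrip_refl.
  by rewrite big_seq1 subnn mulr1.
have [i [lt_i max_i]] : exists i, (part mu i < part la i)%N /\
    forall j, (i < j)%N -> part mu j = part la j.
  pose P i := (part mu i < part la i)%N.
  have exP : exists i, P i.
    apply: contrapT => /forallNP noP; case/eqP: neq; apply: part_inj => i.
    by apply/eqP; rewrite eqn_leq (includedE mula) leqNgt; apply/negP/noP.
  have bP i : P i -> (i <= size la)%N.
    by rewrite /P; have [//|/ltnW/part_default ->] := leqP i (size la).
  case: (ex_maxnP exP bP) => i Pi maxi; exists i; split=> // j lt_ij.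
  apply/eqP; rewrite eqn_leq (includedE mula) leqNgt; apply/negP => /maxi.
  by rewrite leqNgt lt_ij.
(* Row [i] of [ka] has [part mu i] cells or one more. In the first case the row above, if any, has
   at least [part la i] cells, so a cell fits; in the second the row below has at most
   [part mu i.+1] cells, so the last cell is a corner. *)
rewrite (bigID (fun ka => part ka i == part mu i)) /=.
apply/eqP; rewrite addr_eq0 -sumrN; apply/eqP.
have addP ka : hstrip la ka && vstrip ka mu && (part ka i == part mu i) ->
    forall j, part (add_box ka i) j = (part ka j + (j == i))%N.
  move=> /andP[/andP[/hstripP hl _] /eqP eq_i]; apply: part_add_box => j eq_j.
  by rewrite eq_i; have := hl j; rewrite -eq_j; lia.
have delP ka : hstrip la ka && vstrip ka mu && (part ka i != part mu i) ->
    forall j, part (del_box ka i) j = (part ka j - (j == i))%N.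
  move=> /andP[/andP[/hstripP hl /vstripP vm] neq_i]; apply: part_del_box.
  have := max_i i.+1; have := hl i.+1; have := vm i; have := partS mu i; lia.
apply: (sum_bij (h := add_box^~ i) (g := del_box^~ i));
  rewrite ?subpartitions_uniq // => ka _ kaP.
- have aP := addP ka kaP; case/andP: kaP => /andP[/hstripP hl /vstripP vm] /eqP eq_i.
  have hl1 : hstrip la (add_box ka i).
    by apply/hstripP => j; have := hl j; rewrite aP; case: eqVneq => [->|_]; lia.
  have vm1 : vstrip (add_box ka i) mu.
    by apply/vstripP => j; have := vm j; rewrite aP; case: eqVneq => [->|_]; lia.
  have ne1 : part (add_box ka i) i != part mu i by rewrite aP eqxx; lia.
  split; first by rewrite mem_subpartitions hstrip_included.
  + by rewrite hl1 vm1 ne1.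
  + apply: part_inj => j; rewrite delP; last by rewrite hl1 vm1 ne1.
    by rewrite aP addnK.
  + have s_ka := sumn_add1 aP.
    have := included_sumn (hstrip_included hl1); rewrite s_ka => lt_la.
    have le_mu : (sumn mu <= sumn ka)%N by apply/included_sumn/vstrip_included/vstripP.
    by rewrite subSn // -(@subnSK (sumn ka)) // !exprS; ring.
- have dP := delP ka kaP; case/andP: kaP => /andP[/hstripP hl /vstripP vm] neq_i.
  have hl1 : hstrip la (del_box ka i).
    apply/hstripP => j; have := hl j; rewrite dP; case: eqVneq => [->|_]; last lia.
    have := max_i i.+1; have := vm i; have := partS mu i; lia.
  have vm1 : vstrip (del_box ka i) mu.
    by apply/vstripP => j; have := vm j; rewrite dP; case: eqVneq => [->|_]; lia.
  have e1 : part (del_box ka i) i == part mu i.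
    by rewrite dP eqxx; have := vm i; lia.
  split; first by rewrite mem_subpartitions hstrip_included.
  + by rewrite hl1 vm1 e1.
  + apply: part_inj => j; rewrite addP; last by rewrite hl1 vm1 e1.
    by rewrite dP; case: eqVneq => [->|_]; have := vm i; lia.
Qed.

(** The identity [H(- y) E(y) = 1] between complete and elementary generating functions, for strip
    operators: the coefficient of each [f mu] is the sum of [sum_toggle]. *)
Lemma peel_hstrip_vstrip (R : comNzRingType) (y : R) f la :
  peel hstrip (- y) (peel vstrip y f) la = f la.
Proof.
transitivity (\sum_(mu <- subpartitions la) f mu *
   \sum_(ka <- subpartitions la | hstrip la ka && vstrip ka mu)
     (- y) ^+ (sumn la - sumn ka) * y ^+ (sumn ka - sumn mu)).
  under [RHS]eq_bigr do rewrite big_distrr.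
  rewrite (exchange_big_dep (hstrip la)) /=; last by move=> mu ka _ /andP[].
  rewrite /peel; apply: eq_bigr => ka la_ka; rewrite big_distrr /=.
  transitivity (\sum_(mu <- subpartitions la | vstrip ka mu)
    (- y) ^+ (sumn la - sumn ka) * (y ^+ (sumn ka - sumn mu) * f mu)); last first.
    by apply: eq_big => [mu|mu _]; rewrite ?la_ka // mulrA mulrC.
  apply: sum_same; rewrite ?subpartitions_uniq // => mu.
  rewrite !mem_subpartitions; case: (boolP (vstrip ka mu)); rewrite ?andbF //.
  move=> vs; rewrite vstrip_included // (included_trans (vstrip_included vs)) //.
  exact: hstrip_included.
rewrite (bigD1_seq la) ?subpartitions_uniq ?mem_subpartitions ?included_refl //=.
rewrite sum_toggle ?included_refl // eqxx mulr1 big_seq_cond big1 ?addr0 // => mu.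
rewrite mem_subpartitions => /andP[mula /negbTE neq].
by rewrite sum_toggle // neq mulr0.
Qed.

(** The operator is unitriangular: the empty strip contributes [f la] itself, and all other terms
    come from partitions of smaller size. *)
Lemma peel_hstrip_inj (R : comNzRingType) (x : R) f g :
  peel hstrip x f =1 peel hstrip x g -> f =1 g.
Proof.
move=> eq_fg la; have [n] := ubnP (sumn la); elim: n la => // n IHn la lt_n.
pose rest h := \sum_(mu <- subpartitions la | mu != la)
  if hstrip la mu then x ^+ (sumn la - sumn mu) * h mu else 0.
have peelE h : peel hstrip x h la = h la + rest h.
  rewrite /peel big_mkcond (bigD1_seq la) ?subpartitions_uniq //=.
    by rewrite hstrip_refl subnn mul1r.
  by rewrite mem_subpartitions included_refl.
have eq_rest : rest f = rest g.
  apply: eq_bigr => mu neq; case: ifP => // /hstrip_included mula.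
  rewrite IHn //; suff lt_s : (sumn mu < sumn la)%N by apply: leq_trans lt_s lt_n.
  rewrite ltn_neqAle included_sumn // andbT.
  by apply: contraNneq neq => /(included_eq mula) ->.
by have := eq_fg la; rewrite !peelE eq_rest => /addIr.
Qed.

(** Newton's identities [k h_k = p_1 h_(k-1) + ... + p_k h_0], with [P] for the power sums and [H]
    for the complete functions. *)
Definition psums_of (R : comNzRingType) (P H : nat -> R) : Prop :=
  forall k, H k *+ k = \sum_(i < k) P i.+1 * H (k - i.+1)%N.

(** In generating functions [A(t) = B(t) / (1 - x t)], while [P] gains the powers of [x]: the effect
    of one more commuting letter. Both directions matter, because an anticommuting letter [x]
    amounts to deleting a commuting letter [- x]. *)
Lemma psums_of_step (R : comNzRingType) (x : R) (P Q A B : nat -> R) :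
  A 0%N = B 0%N -> (forall k, A k.+1 = B k.+1 + x * A k) ->
  (forall i, P i.+1 = Q i.+1 + x ^+ i.+1) ->
  psums_of P A <-> psums_of Q B.
Proof.
move=> A0 AS PQ.
(* The defect in Newton's identity obeys the same recurrence as [A] and [B] and is 0 at 0, so it
   vanishes for one pair exactly when it does for the other. *)
pose d (P A : nat -> R) k := A k *+ k - \sum_(i < k) P i.+1 * A (k - i.+1)%N.
have dS k : d P A k.+1 = d Q B k.+1 + x * d P A k.
  pose X := \sum_(i < k) x ^+ i.+1 * A (k - i.+1)%N.
  have sumQA : \sum_(i < k.+1) Q i.+1 * A (k - i)%N =
      \sum_(i < k.+1) Q i.+1 * B (k - i)%N +
      x * (\sum_(i < k) P i.+1 * A (k - i.+1)%N - X).
    rewrite !big_ord_recr /= subnn A0 -sumrB big_distrr /= addrAC -big_split /=.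
    congr (_ + _); apply: eq_bigr => i _; rewrite PQ -(subnSK (ltn_ord i)) AS; ring.
  have sumXA : \sum_(i < k.+1) x ^+ i.+1 * A (k - i)%N = x * A k + x * X.
    rewrite big_ord_recl subn0 /= expr1 big_distrr /=; congr (_ + _).
    by apply: eq_bigr => i _; rewrite mulrA -exprS.
  rewrite /d; under eq_bigr do rewrite subSS PQ mulrDl.
  rewrite big_split /= sumQA sumXA; under [in RHS]eq_bigr do rewrite subSS.
  rewrite AS !mulrS mulrnDl -mulrnAr; ring.
have dP P' A' : psums_of P' A' <-> forall k, d P' A' k = 0.
  split=> [eqA k|dA k]; first by rewrite /d eqA subrr.
  by move/eqP: (dA k); rewrite subr_eq0 => /eqP.
rewrite !dP; split=> d0; last first.
  elim=> [|k IHk]; first by rewrite /d mulr0n big_ord0 subrr.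
  by rewrite dS IHk d0 mulr0 addr0.
case=> [|k]; first by rewrite /d mulr0n big_ord0 subrr.
by have := dS k; rewrite !d0 mulr0 addr0.
Qed.

(** * The Pieri rule and power sums *)

Section Naturality.

Variables (V W : zmodType) (phi : {additive V -> W}).

Lemma addh_raddf k f la : addh k (phi \o f) la = phi (addh k f la).
Proof. by rewrite /addh raddf_sum. Qed.

(* Newton's identity [p_(k+1) = (k+1) h_(k+1) - \sum_(i < k) p_(i+1) h_(k-i)],
   with [h_j] acting by [addh j]; [n] is a bound on the depth of recursion. *)
Fixpoint addp (U : zmodType) (n k : nat) (f : intpart -> U) : intpart -> U :=
  if n is n'.+1 then fun la =>
    addh k.+1 f la *+ k.+1 - \sum_(i < k) addp n' i (addh (k - i)%N f) la
  else fun _ => 0.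

(** The operators have integer coefficients, so additive maps such as [D] and truncation pass
    through them. *)
Lemma addp_raddf n k f la : addp n k (phi \o f) la = phi (addp n k f la).
Proof.
elim: n k f la => [|n IHn] k f la /=; first by rewrite raddf0.
rewrite raddfB raddfMn addh_raddf; congr (_ - _); rewrite raddf_sum.
apply: eq_bigr => i _; rewrite -IHn; congr (addp _ _ _ _).
by apply: funext => mu; rewrite addh_raddf.
Qed.

(** [addp] numbers the power sums from [p_1], hence [k.-1]; depth [k] suffices because recursive
    calls have smaller indices. *)
Definition addp_part (U : zmodType) (s : seq nat) (f : intpart -> U) :
    intpart -> U :=
  foldr (fun k => addp k k.-1) f s.

Lemma addp_part_raddf s f la : addp_part s (phi \o f) la = phi (addp_part s f la).
Proof.
elim: s f la => //= k s IHs f la; rewrite -addp_raddf; congr (addp _ _ _ _).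
by apply: funext => mu; rewrite IHs.
Qed.

End Naturality.

(** * Super Schur functions as common eigenvectors *)

Section SuperSchur.

Variable R : comNzRingType.
Implicit Types (f v : intpart -> R) (L : seq (bool * R)).

(* The super Schur functions of an alphabet [L], whose letters are commuting
   ([false]) or anticommuting ([true]): in a super tableau, these fill horizontal
   and vertical strips respectively. *)
Fixpoint super_schur L : intpart -> R :=
  if L is (b, x) :: L' then peel (if b then vstrip else hstrip) x (super_schur L')
  else fun la => (la == empty_part)%:R.

Definition super_psum L (k : nat) : R :=
  \sum_(l <- L) if l.1 then - (- l.2) ^+ k else l.2 ^+ k.

Lemma peel_mull strip x a f la : peel strip x (a \*o f) la = a * peel strip x f la.
Proof. by rewrite /peel big_distrr; apply: eq_bigr => mu _ /=; rewrite mulrCA. Qed.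

Lemma addp_mull n k a f la : addp n k (a \*o f) la = a * addp n k f la.
Proof. exact: (addp_raddf (a \*o idfun)). Qed.

Lemma super_schur0 L : super_schur L empty_part = 1.
Proof.
elim: L => [//|[b x] L IHL] /=.
rewrite /peel (_ : \sum_(mu <- _ | _) _ = \sum_(mu <- [:: empty_part])
    x ^+ (0 - sumn mu) * super_schur L mu).
  by rewrite big_seq1 IHL mulr1.
apply: sum_same; rewrite ?subpartitions_uniq // => mu.
rewrite inE andbT mem_subpartitions; apply/andP/eqP => [[mu0 _]|->].
  by apply: included_eq => //; have := included_sumn mu0; rewrite leqn0 => /eqP.
split; first exact: included_refl.
by case: b; [exact: vstrip_refl | exact: hstrip_refl].
Qed.

Lemma super_schur_pieri L : exists H : nat -> R, [/\ H 0%N = 1,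
  forall k, addh k (super_schur L) = H k \*o super_schur L &
  psums_of (super_psum L) H].
Proof.
elim: L => [|[b x] L [H [H0 HL PH]]].
  exists (fun k => (k == 0)%:R); split=> // [k|[|k]].
  - apply: funext => la /=; case: k => [|k]; first by rewrite addh0 mul1r.
    rewrite mul0r /addh big1 // => nu /andP[_ /eqP s_nu].
    by case: eqP s_nu => // -> /=; rewrite addnS.
  - by rewrite big_ord0.
  - by rewrite mul0rn big1 // => i _; rewrite /super_psum big_nil mul0r.
have PS i : super_psum ((b, x) :: L) i =
    (if b then - (- x) ^+ i else x ^+ i) + super_psum L i.
  by rewrite /super_psum big_cons.
case: b PS => PS.
  pose H' k := if k is k'.+1 then H k + x * H k' else H 0%N.
  have HS k : H k.+1 = H' k.+1 + - x * H k by rewrite /H' mulNr addrK.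
  exists H'; split=> [//|k|]; last first.
    apply: (proj1 (psums_of_step _ HS _) PH) => // i.
    by rewrite PS addrAC addNr add0r.
  (* [peel hstrip (- x)] is injective and undoes the letter [(true, x)], so the
     rule for [L] pulls back along it. *)
  apply: funext; apply: (@peel_hstrip_inj _ (- x)) => la /=.
  set v := peel vstrip x _; have vE : peel hstrip (- x) v = super_schur L.
    by apply: funext => mu; apply: peel_hstrip_vstrip.
  rewrite -[LHS]/(peel _ _ _ _) -[RHS]/(peel _ _ ((H' k) \*o v) _) peel_mull vE.
  case: k => [|k].
    rewrite /= H0 mul1r -vE; congr (peel _ _ _ _).
    by apply: funext => mu; rewrite addh0.
  (* Solved for its last term, this relation gives the factor [H k.+1 + x * H k], which is
     [H' k.+1]. *)
  have := addh_peel (- x) v la k; rewrite vE !HL /= => eq_pieri.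
  by apply: (addrI (- x * (H k * super_schur L la))); rewrite -eq_pieri; ring.
pose H' := fix H' k := if k is k'.+1 then H k + x * H' k' else H 0%N.
exists H'; split=> [//|k|]; last first.
  by apply: (proj2 (@psums_of_step _ x _ _ _ _ _ _ _) PH) => // i; rewrite PS addrC.
apply: funext; elim: k => [|k IHk] la /=; first by rewrite addh0 H0 mul1r.
rewrite addh_peel IHk HL peel_mull /=; ring.
Qed.

(** Each [addh] in the recursion of [addp] becomes a scalar, and the recursion becomes Newton's
    identity solved for its last power sum. *)
Lemma addp_super_schur L n k : (k < n)%N ->
  addp n k (super_schur L) = (super_psum L k.+1) \*o super_schur L.
Proof.
have [H [H0 HL PH]] := super_schur_pieri L.
elim: n k => // n IHn k; rewrite ltnS => le_kn; apply: funext => la /=.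
rewrite HL /= -mulrnAl PH big_ord_recr /= subnn H0 mulr1 mulrDl addrAC.
rewrite big_distrl /= -sumrB big1 ?add0r // => i _.
rewrite HL. rewrite addp_mull IHn ?(leq_trans (ltn_ord i)) //= subSS; ring.
Qed.

Lemma addp_part_super_schur L s : 0%N \notin s ->
  addp_part s (super_schur L) = (\prod_(k <- s) super_psum L k) \*o super_schur L.
Proof.
elim: s => [_|k s IHs] /=.
  by rewrite big_nil; apply: funext => la; rewrite /= mul1r.
rewrite inE negb_or => /andP[k_neq0 s0]; rewrite IHs // big_cons.
apply: funext => la; rewrite addp_mull addp_super_schur ?prednK ?lt0n 1?eq_sym //=; ring.
Qed.

End SuperSchur.

(** * Tableaux *)

Lemma sum_interval a b m : (b <= m)%N -> (\sum_(j < m | a <= j < b) 1 = b - a)%N.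
Proof.
suff -> : (\sum_(j < m | a <= j < b) 1 = minn m b - a)%N by lia.
elim: m => [|m IHm]; first by rewrite big_ord0; lia.
rewrite big_mkcond big_ord_recr /= -big_mkcond /= IHm; case: ifP; lia.
Qed.

Lemma card_outer_cells la mu ka : included mu ka -> included ka la ->
  #|[pred c : cell la mu | part ka (crow c) <= ccol c]%N| = (sumn la - sumn ka)%N.
Proof.
move=> muka kala; rewrite -(card_image val_inj).
transitivity #|[pred p : 'I_(size la) * 'I_(head 0%N la) |
                part ka p.1 <= p.2 < part la p.1]%N|.
  apply: eq_card => p; rewrite inE; apply/imageP/idP.
    by case=> c; rewrite inE => ka_c ->; rewrite ka_c; case/andP: (cellP c).
  move=> /andP[ka_p p_la].
  have p_in : (part mu p.1 <= p.2 < part la p.1)%N.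
    by rewrite p_la andbT; apply: leq_trans (includedE muka _) ka_p.
  by exists (Sub p p_in : cell la mu).
rewrite -sum1_card -(pair_big_dep xpredT
  (fun (i : 'I_(size la)) (j : 'I_(head 0%N la)) => part ka i <= j < part la i)%N
  (fun _ _ => 1%N)) /=.
under eq_bigr do rewrite sum_interval ?part_head //.
rewrite sumnB => [|i _]; last exact: includedE.
rewrite -!sumn_partE // leqNgt -Defs.part_gt0; apply/negP => lt0.
by have := leq_trans lt0 (includedE kala _); rewrite part_default.
Qed.

Section Tableaux.

Variables (R : comNzRingType) (v : nat -> R).

(** The skew Schur polynomial of [la / mu] at the values [v]. These are indexed by [nat], so that
    [n] can vary in an induction while [v] stays fixed. *)
Definition tableau_sum la mu n : R :=
  \sum_(T : {ffun cell la mu -> 'I_n} | semistandard T) \prod_c v (T c).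

Lemma tableau_sum0 la mu : included mu la -> tableau_sum la mu 0 = (la == mu)%:R.
Proof.
move=> mula; rewrite /tableau_sum.
case: eqVneq => [->|neq].
  have no_cell (c : cell mu mu) : False.
    by have := cellP c; rewrite ltnNge; case: leqP.
  rewrite (big_pred1 [ffun c => False_rect _ (no_cell c)]) => [|T /=].
    by rewrite big1 // => c; case: (no_cell c).
  rewrite [semistandard T](_ : _ = true).
    by apply/esym/eqP/ffunP => c; case: (no_cell c).
  by apply/semistandardP; split=> c; case: (no_cell c).
have [i lt_i] : exists i, (part mu i < part la i)%N.
  apply: contrapT => /forallNP no_i; case/eqP: neq; apply: part_inj => i.
  by apply/eqP; rewrite eqn_leq (includedE mula) andbT leqNgt; apply/negP/no_i.
have [c _ _] : exists2 c : cell la mu, crow c = i & ccol c = part mu i.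
  by apply: ex_cell; rewrite leqnn.
by rewrite big1 // => T; case: (T c).
Qed.

Section Peel.

Variables (la mu : intpart) (n : nat).
Hypothesis mula : included mu la.

(** [ka] is the outer boundary of the cells whose entry is not the largest value [n]. *)
Definition cut_at (T : {ffun cell la mu -> 'I_n.+1}) (ka : intpart) : bool :=
  [forall c, (T c < n) == (ccol c < part ka (crow c))]%N.

Lemma cut_atP (T : {ffun cell la mu -> 'I_n.+1}) ka :
  reflect (forall c, (T c < n) = (ccol c < part ka (crow c)))%N (cut_at T ka).
Proof. exact: 'forall_eqP. Qed.

Lemma cut_exists (T : {ffun cell la mu -> 'I_n.+1}) : semistandard T ->
  exists ka, [/\ included mu ka, hstrip la ka & cut_at T ka].
Proof.
move=> /semistandardP[T_row T_col].
(* [part mu i] covers rows without entries below [n]; [.+1] turns the last such column, counted from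
   0, into a length. *)
pose f i := maxn (part mu i) (\max_(c | (crow c == i) && (T c < n)) (ccol c).+1)%N.
have cutf c : (T c < n)%N = (ccol c < f (crow c))%N.
  apply/idP/idP => [Tc|].
    by rewrite leq_max (bigmax_sup c) ?orbT // eqxx.
  apply: contraTT; rewrite -!leqNgt => Tc; rewrite geq_max.
  have /andP[-> _] := cellP c; apply/bigmax_leqP => d /andP[/eqP rd Td].
  rewrite ltnNge; apply/negP => le_cd.
  suff le_T : (T c <= T d)%N by have := leq_trans Tc le_T; rewrite leqNgt Td.
  move: le_cd; rewrite leq_eqVlt => /predU1P[eq_c|lt_cd]; last exact: T_row.
  by rewrite (_ : c = d) //; apply: cell_inj.
have f_la i : (f i <= part la i)%N.
  rewrite geq_max includedE //; apply/bigmax_leqP => c /andP[/eqP <- _].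
  by case/andP: (cellP c).
have mu_f i : (part mu i <= f i)%N by rewrite leq_maxl.
have below i j (c : cell la mu) : crow c = i.+1 -> ccol c = j -> (part mu i <= j)%N ->
    (T c <= n)%N -> (j < f i)%N.
  move=> rc cc le_j Tc.
  have [d rd cd] : exists2 d : cell la mu, crow d = i & ccol d = j.
    apply: ex_cell; rewrite le_j /=; have /andP[_] := cellP c.
    by rewrite rc cc => /leq_trans -> //; apply: partS.
  rewrite -cd -rd -cutf; apply: leq_trans Tc.
  by apply: T_col; rewrite ?cd ?cc // rd rc.
have la_f i : (part la i.+1 <= f i)%N.
  (* Otherwise the cell of row [i.+1] in column [f i] lies, by column strictness, under an entry
     below [n], which [cutf] puts in a column before [f i]. *)
  rewrite leqNgt; apply/negP => lt_f.
  have [c rc cc] : exists2 c : cell la mu, crow c = i.+1 & ccol c = f i.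
    by apply: ex_cell; rewrite lt_f (leq_trans (partS mu i)).
  have := below i _ c rc cc (mu_f i); rewrite -ltnS ltn_ord ltnn => /(_ isT).
  by [].
have kaE := @part_mkpart f (size la) (fun i => leq_trans (f_la i.+1) (la_f i)).
have {}kaE : part (mkpart f (size la)) =1 f.
  by apply: kaE; apply/eqP; rewrite -leqn0 (leq_trans (f_la _)) ?part_default.
exists (mkpart f (size la)); split.
- by apply/includedP => i; rewrite kaE.
- by apply/hstripP => i; rewrite kaE.
- by apply/cut_atP => c; rewrite kaE.
Qed.

(** Where row lengths differ, the first cell past the shorter row would have an entry both below [n]
    and equal to [n]. *)
Lemma cut_unique (T : {ffun cell la mu -> 'I_n.+1}) ka ka' :
  included mu ka -> included mu ka' ->
  included ka la -> included ka' la -> cut_at T ka -> cut_at T ka' -> ka = ka'.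
Proof.
move=> muka muka' kala kala' /cut_atP cutk /cut_atP cutk'.
suff le_p k k' : included mu k -> included mu k' -> included k la ->
    (forall c, (T c < n) = (ccol c < part k (crow c)))%N ->
    (forall c, (T c < n) = (ccol c < part k' (crow c)))%N ->
    forall i, (part k i <= part k' i)%N.
  by apply: part_inj => i; apply/eqP; rewrite eqn_leq !le_p.
move=> muk muk' kla cut cut' i; rewrite leqNgt; apply/negP => lt_k.
have [c rc cc] : exists2 c : cell la mu, crow c = i & ccol c = part k' i.
  by apply: ex_cell; rewrite (includedE muk') (leq_trans lt_k) ?(includedE kla).
by have := cut' c; rewrite cut rc cc lt_k ltnn.
Qed.

Section Extension.

Variable ka : intpart.
Hypotheses (muka : included mu ka) (laka : hstrip la ka).

Lemma embed_exists : exists emb : cell ka mu -> cell la mu,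
  forall c, crow (emb c) = crow c /\ ccol (emb c) = ccol c.
Proof.
apply: (@fin_all_exists _ _
  (fun c (d : cell la mu) => crow d = crow c /\ ccol d = ccol c)) => c.
have [d rd cd] : exists2 d : cell la mu, crow d = crow c & ccol d = ccol c.
  apply: ex_cell; case/andP: (cellP c) => -> /leq_trans -> //.
  exact: includedE (hstrip_included laka) _.
by exists d.
Qed.

(** Filling [la / ka] with [n] is a bijection from the tableaux of shape [ka / mu] with entries
    below [n]: no two new cells share a column, since [la / ka] is a horizontal strip. *)
Lemma tableau_sum_cut :
  \sum_(T : {ffun cell la mu -> 'I_n.+1} | semistandard T && cut_at T ka)
    \prod_c v (T c) =
  v n ^+ (sumn la - sumn ka) * tableau_sum ka mu n.
Proof.
have [emb embE] := embed_exists.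
have remb c : crow (emb c) = crow c by have [] := embE c.
have cemb c : ccol (emb c) = ccol c by have [] := embE c.
have emb_inj : injective emb.
  by move=> c d eq_cd; apply: cell_inj; rewrite -?remb -?cemb eq_cd.
have embP c : (ccol c < part ka (crow c))%N -> exists c', c = emb c'.
  move=> lt_c; have [c' rc' cc'] : exists2 c', @crow ka mu c' = crow c & ccol c' = ccol c.
    by apply: ex_cell; rewrite lt_c andbT; case/andP: (cellP c).
  by exists c'; apply: cell_inj; rewrite ?remb ?cemb.
have emb_in c : (ccol (emb c) < part ka (crow (emb c)))%N.
  by rewrite remb cemb; case/andP: (cellP c).
pose ext (T : {ffun cell ka mu -> 'I_n}) : {ffun cell la mu -> 'I_n.+1} :=
  [ffun c => if [pick c' | emb c' == c] is Some c' then widen_ord (leqnSn n) (T c')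
             else ord_max].
have ext_emb T c : ext T (emb c) = T c :> nat.
  rewrite ffunE; case: pickP => [d /eqP/emb_inj -> //|/(_ c)].
  by rewrite eqxx.
have ext_out T c : (part ka (crow c) <= ccol c)%N -> ext T c = n :> nat.
  rewrite ffunE; case: pickP => // d /eqP <-.
  by rewrite leqNgt emb_in.
have ext_inj : injective ext.
  move=> T1 T2 eq_T; apply/ffunP => c; apply: val_inj.
  by rewrite /= -!ext_emb eq_T.
have ext_cut T : cut_at (ext T) ka.
  apply/cut_atP => c; case: (ltnP (ccol c)) => [/embP[c' ->]|/ext_out ->];
    last by rewrite ltnn.
  by rewrite ext_emb ltn_ord.
have ext_ss T : semistandard (ext T) = semistandard T.
  apply/semistandardP/semistandardP => -[T_row T_col]; split=> c d.
  - by move=> rcd ccd; rewrite -!ext_emb; apply: T_row; rewrite ?remb ?cemb.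
  - by move=> ccd rcd; rewrite -!ext_emb; apply: T_col; rewrite ?remb ?cemb.
  - move=> rcd ccd; have [/embP[d' eq_d]|le_d] := ltnP (ccol d) (part ka (crow d));
      last first.
      by rewrite (ext_out _ d) // -ltnS.
    have /embP[c' eq_c] : (ccol c < part ka (crow c))%N.
      by rewrite rcd (ltn_trans ccd) // eq_d.
    by move: rcd ccd; rewrite eq_c eq_d !remb !cemb !ext_emb; apply: T_row.
  - move=> ccd rcd; have [/embP[c' eq_c]|le_c] := ltnP (ccol c) (part ka (crow c));
      last first.
      (* No cell of [la] lies below a cell of [la / ka], so this case is void. *)
      have /andP[_] := cellP d; rewrite -ccd ltnNge.
      have /hstripP/(_ (crow c))[le_la _] := laka.
      by rewrite (leq_trans (part_anti la rcd)) // (leq_trans le_la).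
    have [/embP[d' eq_d]|le_d] := ltnP (ccol d) (part ka (crow d));
      last first.
      by rewrite (ext_out _ d) // eq_c ext_emb.
    by move: rcd ccd; rewrite eq_c eq_d !remb !cemb !ext_emb => r e; apply: T_col.
transitivity (\sum_(T in ext @: [set T | semistandard T]) \prod_c v (T c)).
  apply: eq_bigl => T; apply/andP/imsetP =>
    [[T_ss /cut_atP cutT]|[T' T'_ss ->]]; last first.
    by rewrite ext_ss ext_cut; rewrite inE in T'_ss.
  have /fin_all_exists[T' T'P] c : exists j : 'I_n, T (emb c) = widen_ord (leqnSn n) j.
    have lt_T : (T (emb c) < n)%N by rewrite cutT.
    by exists (Ordinal lt_T); apply: val_inj.
  have eqT : T = ext (finfun T').
    apply/ffunP => c; apply: val_inj => /=.
    have [/embP[c' ->]|le_c] := ltnP (ccol c) (part ka (crow c)).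
      by rewrite ext_emb ffunE T'P.
    rewrite ext_out //; apply/eqP; rewrite eqn_leq -ltnS ltn_ord leqNgt cutT.
    by rewrite -leqNgt.
  by exists (finfun T'); rewrite // inE -ext_ss -eqT.
rewrite big_imset /=; last by move=> T1 T2 _ _; apply: ext_inj.
rewrite /tableau_sum big_distrr /=; apply: eq_big => T; first by rewrite inE.
move=> _; rewrite mulrC (bigID (fun c => ccol c < part ka (crow c))%N) /=.
congr (_ * _).
  transitivity (\prod_(c in emb @: setT) v (ext T c)).
    apply: eq_bigl => c; apply/idP/imsetP => [/embP[c' ->]|[c' _ ->]] //.
    by exists c'.
  rewrite big_imset /=; last by move=> c d _ _; apply: emb_inj.
  by apply: eq_big => [c|c _]; rewrite ?inE // ext_emb.
transitivity (\prod_(c : cell la mu | (part ka (crow c) <= ccol c)%N) v n).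
  by apply: eq_big => [c|c]; rewrite -leqNgt // => /ext_out ->.
by rewrite prodr_const -(card_outer_cells muka) // hstrip_included.
Qed.

End Extension.

(** Every tableau is cut at [n] by exactly one [ka], so a sum over [ka] can be inserted and
    exchanged with the sum over tableaux. *)
Lemma tableau_sumS : tableau_sum la mu n.+1 =
  \sum_(ka <- subpartitions la | hstrip la ka && included mu ka)
    v n ^+ (sumn la - sumn ka) * tableau_sum ka mu n.
Proof.
transitivity (\sum_(T : {ffun cell la mu -> 'I_n.+1} | semistandard T)
  \sum_(ka <- subpartitions la | [&& hstrip la ka, included mu ka & cut_at T ka])
    \prod_c v (T c)).
  apply: eq_bigr => T T_ss; have [ka [muka laka cutT]] := cut_exists T_ss.
  rewrite -[LHS](big_seq1 +%R ka (fun=> \prod_c v (T c))).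
  apply: sum_same; rewrite ?subpartitions_uniq // => ka'.
  rewrite inE andbT mem_subpartitions; apply/eqP/and4P => [->|[? ? ? cutT']].
    by rewrite hstrip_included.
  by apply: (cut_unique _ _ _ _ cutT' cutT) => //; apply: hstrip_included.
rewrite (exchange_big_dep (fun ka => hstrip la ka && included mu ka)) /=; last first.
  by move=> T ka _ /and3P[-> ->].
apply: eq_bigr => ka /andP[laka muka]; rewrite -tableau_sum_cut //.
by apply: eq_bigl => T; rewrite laka muka.
Qed.

End Peel.

End Tableaux.

(** * Conjugation *)

(** [part_conj] describes conjugate parts only through [j < _]; comparisons of parts are brought to
    this form. *)
Lemma leq_ext a b : (forall j, j < a -> j < b)%N -> (a <= b)%N.
Proof. by case: a => // a lt_ab; apply: lt_ab. Qed.

Lemma conj_partK : involutive conj_part.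
Proof.
move=> la; apply: part_inj => i; apply/eqP; rewrite eqn_leq.
by apply/andP; split; apply: leq_ext => j; rewrite !part_conj.
Qed.

Lemma included_conj la mu : included (conj_part mu) (conj_part la) = included mu la.
Proof.
suff imp nu ka : included nu ka -> included (conj_part nu) (conj_part ka).
  by apply/idP/idP => /imp //; rewrite !conj_partK.
move=> /includedP le_p; apply/includedP => i; apply: leq_ext => j.
by rewrite !part_conj => /leq_trans ->.
Qed.

Lemma hstrip_conj la mu : hstrip (conj_part la) (conj_part mu) = vstrip la mu.
Proof.
apply/hstripP/vstripP => strip i; split.
- apply: leq_ext => j; rewrite -(part_conj mu j i) -(part_conj la j i).
  by move=> /leq_trans -> //; case: (strip j).
- suff : ((part la i).-1 <= part mu i)%N by lia.
  apply: leq_ext => j lt_j; rewrite -(part_conj mu j i).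
  have lt_i : (i < part (conj_part la) j.+1)%N by rewrite part_conj; lia.
  by apply: leq_trans lt_i _; case: (strip j).
- apply: leq_ext => j; rewrite !part_conj => lt_i.
  by case: (strip j) => _ le_la; rewrite -ltnS; apply: leq_trans le_la.
- apply: leq_ext => j; rewrite !part_conj => lt_i.
  by case: (strip j) => le_mu _; apply: leq_trans le_mu.
Qed.

Lemma size_conj la : size (conj_part la) = head 0%N la.
Proof. by rewrite size_map size_iota. Qed.

(** Cells are counted by rows or by columns of an [N] by [N] square that contains both diagrams. *)
Lemma sumn_conj la : sumn (conj_part la) = sumn la.
Proof.
pose N := (size la + head 0 la)%N.
have sumE mu M : (part mu 0 <= M)%N -> (size mu <= N)%N ->
    sumn mu = (\sum_(i < N) \sum_(j < M | j < part mu i) 1)%N.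
  move=> le_M le_N; rewrite (sumn_partE le_N); apply: eq_bigr => i _.
  rewrite -[LHS]subn0 -(@sum_interval _ _ M) //.
  exact: leq_trans (part_anti mu (leq0n i)) le_M.
have la0 : (part la 0 <= N)%N by rewrite /part nth0 leq_addl.
have conj0 : (part (conj_part la) 0 <= N)%N.
  apply: leq_ext => j; rewrite part_conj Defs.part_gt0 => /leq_trans -> //.
  exact: leq_addr.
rewrite (sumE (conj_part la) N) ?(sumE la N) ?leq_addr ?size_conj ?leq_addl //.
rewrite (exchange_big_dep xpredT) //=.
by apply: eq_bigr => i _; apply: eq_bigl => j; rewrite part_conj.
Qed.

Lemma super_psum_cat (R : comNzRingType) (L L' : seq (bool * R)) k :
  super_psum (L ++ L') k = super_psum L k + super_psum L' k.
Proof. exact: big_cat. Qed.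

Section Letters.

Variables (R : comNzRingType) (v : nat -> R).

(** The letter of largest index comes first because it is peeled first, as in [tableau_sumS]. *)
Fixpoint letters (b : bool) (n : nat) : seq (bool * R) :=
  if n is n'.+1 then (b, v n') :: letters b n' else [::].

Lemma tableau_sum_super_schur n la :
  tableau_sum v la empty_part n = super_schur (letters false n) la.
Proof.
have inc0 mu : included empty_part mu by apply/includedP => i; rewrite part_default.
elim: n la => [|n IHn] la; first by rewrite tableau_sum0.
rewrite tableau_sumS //= /peel; apply: eq_big => [mu|mu _]; first by rewrite inc0 andbT.
by rewrite IHn.
Qed.

Lemma conj_tableau_sumS la mu n : included mu la ->
  tableau_sum v (conj_part la) (conj_part mu) n.+1 =
  \sum_(ka <- subpartitions la | vstrip la ka && included mu ka)
    v n ^+ (sumn la - sumn ka) * tableau_sum v (conj_part ka) (conj_part mu) n.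
Proof.
move=> mula; rewrite tableau_sumS ?included_conj //.
apply: (sum_bij (h := conj_part) (g := conj_part));
  rewrite ?subpartitions_uniq // => ka; rewrite !mem_subpartitions.
  rewrite -[ka]conj_partK; move: (conj_part ka) => nu.
  rewrite !included_conj hstrip_conj !sumn_conj !conj_partK.
  by move=> -> /andP[-> ->].
by rewrite -hstrip_conj !included_conj conj_partK => -> ->.
Qed.

(** In a super tableau the letters of [L] fill a diagram [mu]; the rest, filled with anticommuting
    letters, becomes an ordinary tableau by transposition. For [L] a commuting copy of the
    variables, the left side is the truncated value of [D] on [schur la]. *)
Lemma super_schur_conj L n la :
  \sum_(mu <- subpartitions la)
    super_schur L mu * tableau_sum v (conj_part la) (conj_part mu) n =
  super_schur (letters true n ++ L) la.
Proof.
elim: n la => [|n IHn] la /=.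
  rewrite (bigD1_seq la) ?subpartitions_uniq ?mem_subpartitions ?included_refl //=.
  rewrite tableau_sum0 ?included_refl // eqxx mulr1 big_seq_cond big1 ?addr0 // => mu.
  rewrite mem_subpartitions => /andP[mula neq].
  rewrite tableau_sum0 ?included_conj // (can_eq conj_partK).
  by rewrite eq_sym (negbTE neq) mulr0.
rewrite /peel; transitivity (\sum_(mu <- subpartitions la)
    \sum_(ka <- subpartitions la | vstrip la ka && included mu ka)
      v n ^+ (sumn la - sumn ka) *
      (super_schur L mu * tableau_sum v (conj_part ka) (conj_part mu) n)).
  apply: eq_big_seq => mu; rewrite mem_subpartitions => mula.
  rewrite conj_tableau_sumS // big_distrr /=.
  by apply: eq_bigr => ka _; rewrite mulrCA.
rewrite (exchange_big_dep (vstrip la)) /=; last by move=> mu ka _ /andP[].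
apply: eq_bigr => ka laka; rewrite -IHn big_distrr /=.
apply: sum_same; rewrite ?subpartitions_uniq // => mu.
rewrite !mem_subpartitions laka andbT /=; case: (boolP (included mu ka)); rewrite ?andbF //.
by move=> /included_trans -> //; apply: vstrip_included.
Qed.

Lemma super_psum_letters b n k : super_psum (letters b n) k =
  if b then - \sum_(i < n) (- v i) ^+ k else \sum_(i < n) v i ^+ k.
Proof.
rewrite /super_psum; elim: n => [|n IHn] /=.
  by rewrite big_nil !big_ord0 oppr0 if_same.
rewrite big_cons IHn !big_ord_recr /=; case: (b); rewrite ?opprD addrC //.
Qed.

(** The source of the two cases of the theorem: [v i ^+ k] and [- (- v i) ^+ k] are equal for odd
    [k] and cancel for even [k]. *)
Lemma super_psum_double n k : super_psum (letters true n ++ letters false n) k =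
  if odd k then (\sum_(i < n) v i ^+ k) *+ 2 else 0.
Proof.
rewrite super_psum_cat !super_psum_letters.
under eq_bigr do rewrite exprNn -signr_odd.
rewrite -mulr_sumr; case: (odd k); rewrite /= ?expr0 ?expr1.
  by rewrite mulN1r opprK mulr2n.
by rewrite mul1r addNr.
Qed.

End Letters.

(** * Truncation to finitely many variables *)

(** Defined for all indices, with value 0 past the last variable, to serve as the [v] of
    [tableau_sum]. *)
Definition var n (i : nat) : {mpoly rat[n]} := oapp (fun j : 'I_n => 'X_j) 0 (insub i).

Lemma var_ord n (i : 'I_n) : var n i = 'X_i.
Proof. by rewrite /var valK. Qed.

Lemma symfunP (f g : symfun) : (forall n, family_of f n = family_of g n) -> f = g.
Proof. by move=> eq_fg; apply: val_inj; apply: Defs.familyP. Qed.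

Definition truncate n : symfun -> {mpoly rat[n]} := component n \o val.
HB.instance Definition _ n := GRing.RMorphism.on (@truncate n).

Arguments truncate : simpl never.

Lemma truncateZ n a f : truncate n (a *: f) = a *: truncate n f.
Proof. by []. Qed.

Lemma truncate_skew_schur n la mu :
  truncate n (skew_schur la mu) = tableau_sum (var n) la mu n.
Proof.
apply: eq_bigr => T _; apply: eq_bigr => c _; exact/esym/var_ord.
Qed.

Lemma truncate_psum n k : (0 < k)%N -> truncate n (psum k) = \sum_(i < n) 'X_i ^+ k.
Proof. by rewrite /truncate /= /component /psum_family => ->. Qed.

Lemma truncate_psum_part n (la : intpart) :
  truncate n (psum_part la) = \prod_(k <- la) \sum_(i < n) 'X_i ^+ k.
Proof.
rewrite rmorph_prod; apply: eq_big_seq => k k_la; apply: truncate_psum.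
by rewrite lt0n; have /andP[_] := partsP la; apply: contraNneq => <-.
Qed.

(** The right side is an integer combination of Schur functions, to which a linear map applies
    termwise. In each truncation the Schur functions are eigenvectors of the operators and
    [schur empty_part] is 1, which leaves the product of power sums. *)
Lemma psum_partE (la : intpart) : psum_part la = addp_part la schur empty_part.
Proof.
have /andP[_ la0] := partsP la.
apply: symfunP => n; rewrite -[LHS]/(truncate n _) -[RHS]/(truncate n _).
rewrite -addp_part_raddf (_ : _ \o _ = super_schur (letters (var n) false n)).
  rewrite addp_part_super_schur //= super_schur0 mulr1 truncate_psum_part.
  apply: eq_bigr => k _; rewrite super_psum_letters.
  by apply: eq_bigr => i _; rewrite var_ord.
apply: funext => mu /=.
by rewrite truncate_skew_schur tableau_sum_super_schur.
Qed.

Lemma psum_part_neq0 la : psum_part la != 0.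
Proof.
(* In one variable, each factor is a power of that variable. *)
apply/eqP => /(congr1 (truncate 1)); rewrite truncate_psum_part raddf0.
apply/eqP; rewrite prodf_seq_neq0; apply/allP => k _ /=.
by rewrite big_ord1 mpolyXn -msize_poly_eq0 msizeX.
Qed.

Theorem corollary3p3 (D : {linear symfun -> symfun})
    (D_schur : forall nu : intpart,
       D (schur nu) = \sum_(mu <- subpartitions nu)
                        schur mu * skew_schur (conj_part nu) (conj_part mu))
    (la : intpart) :
  psum_part la != 0 /\
  D (psum_part la) =
    if all odd la then 2 ^+ size la *: psum_part la else 0.
Proof.
split; first exact: psum_part_neq0.
have /andP[_ la0] := partsP la.
apply: symfunP => n; rewrite -[LHS]/(truncate n _) -[RHS]/(truncate n _).
(* Naturality moves [D] and the truncation inside, so that the operators act on the truncations of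
   [D (schur nu)], which are the super Schur functions of [X/X]. *)
rewrite {1}psum_partE -!addp_part_raddf.
rewrite (_ : _ \o _ = super_schur (letters (var n) true n ++ letters (var n) false n)).
  rewrite addp_part_super_schur //= super_schur0 mulr1.
  rewrite (fun_if (truncate n)) truncateZ raddf0 truncate_psum_part.
  elim: (parts la) => [|k s IHs] /=; first by rewrite !big_nil scale1r.
  rewrite !big_cons IHs super_psum_double.
  case: (odd k) => /=; last by rewrite mul0r.
  case: ifP => _; last by rewrite mulr0.
  under [in LHS]eq_bigr do rewrite var_ord.
  by rewrite -scalerAr mulrnAl exprS mulr_natl -scalerMnl scalerMnr.
apply: funext => nu /=; rewrite D_schur raddf_sum /= -super_schur_conj.
apply: eq_bigr => mu _; rewrite rmorphM /= !truncate_skew_schur.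
by rewrite tableau_sum_super_schur.
Qed.
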